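(* Let $R$ be a Hecke symmetry (with arbitrary parameter $q$) on a $3$-dimensional vector space $V$ over a field $\Bbbk$ of characteristic $\neq 2,3$. Then $\mathbb{S}(V,R)$ is not an Artin–Schelter regular algebra of type $A$.
   Context: A Hecke symmetry on $V$ with parameter $0\neq q\in\Bbbk$ is a linear map $R:V\otimes V\to V\otimes V$ satisfying $(R\otimes\mathrm{Id}_V)(\mathrm{Id}_V\otimes R)(R\otimes\mathrm{Id}_V)=(\mathrm{Id}_V\otimes R)(R\otimes\mathrm{Id}_V)(\mathrm{Id}_V\otimes R)$ and $(R-q\,\mathrm{Id})(R+\mathrm{Id})=0$ ($q=-1$ and roots of unity allowed). $\mathbb{S}(V,R)$ is the quotient of the tensor algebra $\mathbb{T}(V)$ by the ideal generated by $\mathrm{Im}(R-q\,\mathrm{Id})\subset V^{\otimes2}$, a graded algebra generated in degree $1$ by $V$. For $a,b,c$ in a field, $\mathrm{Skl}_3(a,b,c)$ is the graded algebra generated by $x_1,x_2,x_3$ in degree 1 with the three relations $a x_{i+1}x_{i-1}+b x_{i-1}x_{i+1}+c x_i^2=0$, $i\in\mathbb{Z}/3\mathbb{Z}$. The $3$-dimensional Artin–Schelter regular quadratic algebras of type $A$ (in the sense of Artin–Tate–Van den Bergh: the point scheme is a smooth cubic curve and the associated automorphism is a translation) are, over an algebraically closed field, precisely the algebras $\mathrm{Skl}_3(a,b,c)$ with $abc\neq0$ and $(a^3+b^3+c^3)^3\neq 27a^3b^3c^3$; for an algebra over $\Bbbk$ being of type $A$ means this holds after extension of scalars to an algebraic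 closure of $\Bbbk$, as graded algebras. *)

(* Defs.v *)
From HB Require Import structures.
From mathcomp Require Import all_boot all_order all_algebra.
From mathcomp Require Import mxtens.
Set Implicit Arguments. Unset Strict Implicit. Unset Printing Implicit Defensive.
Import Order.TTheory GRing.Theory Num.Theory.
Local Open Scope ring_scope.

(* Conventions: V = k^3 as row vectors 'rV[k]_3, linear maps act on the right
   (v |-> v *m A).  V (x) V = 'rV[k]_(3*3), with e_i (x) e_j at index
   mxtens_index (i, j); the tensor product of linear maps is the Kronecker
   product [tensmx] (notation A *t B) from mathcomp.real_closed.mxtens.
   V (x) V (x) V = 'rV_((3*3)*3); the identification with 'rV_(3*(3*3))
   is the associativity cast (index values coincide). *)

Notation "A *t B" := (tensmx A B)
  (at level 40, left associativity, format "A  *t  B") : ring_scope.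

Section Hecke.
Variable k : fieldType.

Definition R12 (R : 'M[k]_(3*3)) : 'M[k]_(3*3*3) := R *t (1%:M : 'M[k]_3).
Definition R23 (R : 'M[k]_(3*3)) : 'M[k]_(3*3*3) :=
  castmx (mulnA 3 3 3, mulnA 3 3 3) ((1%:M : 'M[k]_3) *t R).

Definition hecke_symmetry (q : k) (R : 'M[k]_(3*3)) : Prop :=
  R12 R *m R23 R *m R12 R = R23 R *m R12 R *m R23 R /\
  (R - q%:M) *m (R + 1%:M) = 0.

(* The quadratic relations of S(V,R): the row space of (R - q Id), i.e.
   Im(R - q Id) in V (x) V. *)
Definition sym_relations (q : k) (R : 'M[k]_(3*3)) : 'M[k]_(3*3) := R - q%:M.
End Hecke.

(* Relations of Skl_3(a,b,c): row i is
   a x_{i+1} x_{i-1} + b x_{i-1} x_{i+1} + c x_i^2, indices in Z/3Z. *)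
Definition skl_relations (L : fieldType) (a b c : L) : 'M[L]_(3, 3*3) :=
  \matrix_(i < 3, j < 3*3)
     (a * (j == mxtens_index ((i + 1)%R, (i - 1)%R))%:R
    + b * (j == mxtens_index ((i - 1)%R, (i + 1)%R))%:R
    + c * (j == mxtens_index (i, i))%:R).

(* Isomorphism of graded quadratic algebras T(V)/(W) ~= T(V')/(W') (both
   generated in degree 1 by 3-dim spaces): a linear isomorphism g of the
   degree-one parts with (g (x) g)(W) = W'. *)
Definition quad_iso (L : fieldType) m n (W : 'M[L]_(m, 3*3)) (W' : 'M[L]_(n, 3*3))
  : Prop :=
  exists g : 'M[L]_3, g \in unitmx /\ (W *m (g *t g) == W')%MS.

Definition is_alg_closure (k : fieldType) (L : closedFieldType)
  (f : {rmorphism k -> L}) : Prop :=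
  forall x : L, exists p : {poly k}, p != 0 /\ root (map_poly f p) x.

Definition AS_regular_typeA (k : fieldType) m (W : 'M[k]_(m, 3*3)) : Prop :=
  exists (L : closedFieldType) (f : {rmorphism k -> L}),
    is_alg_closure f /\
    exists a b c : L,
      a * b * c != 0 /\
      (a ^+ 3 + b ^+ 3 + c ^+ 3) ^+ 3 != 27%:R * a ^+ 3 * b ^+ 3 * c ^+ 3 /\
      quad_iso (map_mx f W) (skl_relations a b c).

(* Main.v *)
Require Import Defs.
From HB Require Import structures.
From mathcomp Require Import all_boot all_order all_algebra.
From mathcomp Require Import mxtens.
Import GRing.Theory.
Local Open Scope ring_scope.
From mathcomp Require Import ring.

(* Over the closure the relations are the partial derivatives of a cyclic
   potential, the trilinear form c with c(i, m, n) = Skl_3(a, b, c)_i(m, n), and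
   q - R is the composite of two maps V (x) V -> V -> V (x) V given by a tensor f
   and by c.  The Hecke relation says that c and f pair to 1 + q (the "bigon").
   Since W (x) V and V (x) W, for W the span of the relations, meet in the line
   of c, the braid relation becomes a "square" identity for c, f, c, f that
   holds up to an unknown matrix X.  Gluing such identities shows that
   nu = X / q fixes c, rotates f cyclically, and has tr nu = tr nu^-1 =
   1 + q + 1 / q.  Genericity of (a, b, c) makes c nondegenerate: c(x, x, _) = 0
   only for x = 0.  This forces nu to be diagonalizable, and in an eigenbasis the
   vanishing of c_ijk unless d_i d_j d_k = 1, the traces, and finitely many bigon
   and square equations exclude every spectrum but nu = 1, q = 1.  Then f is
   cyclic, hence of the same shape as c with parameters (a', b', c'), and the
   remaining equations in a a', b b', c c' force
   (a^3 + b^3 + c^3)^3 = 27 a^3 b^3 c^3. *)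

Set Implicit Arguments. Unset Strict Implicit. Unset Printing Implicit Defensive.

(** * Tensors in an eigenbasis of the twist *)

(** Since q = -1 is allowed, q - R cannot in general be rescaled to a projection, so no step divides
    by 1 + q. The factorization of q - R through V is split instead by a left inverse that comes
    from the equality of row spaces.

    There are two square identities, one from each side of the braid relation, with unknown matrices
    X and X'. In the combination sum_a X(a, v) f(a, ., .) - q f(., v, .) their terms of the wrong
    shape cancel, and nondegeneracy then kills it. This is the rotation law, and it yields X' X =
    q^2 as a by-product.

    The traces alone leave too many spectra. The list becomes finite because nondegeneracy at an
    eigenvector e_i makes some c(i, i, .) nonzero: either d_i^3 = 1, or d_i^2 d_j = 1 for another
    index j, called below an arrow from i to j.

    Genericity of (a, b, c) enters three times: it gives c^3 + (a + b)^3 <> 0, hence nondegeneracy;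
    it excludes a^3 = b^3 = c^3, hence W (x) V and V (x) W meet in a line only; and it is what the
    final computation contradicts. *)

Lemma sum3 (V : nmodType) (i j k : 'I_3) (F : 'I_3 -> V) :
  i != j -> i != k -> j != k -> \sum_x F x = F i + F j + F k.
Proof.
move=> ij ik jk; rewrite (bigD1 i) //= (bigD1 j) ?(eq_sym j) //= (bigD1 k) /=; last first.
  by rewrite !(eq_sym k) ik.
rewrite big1 ?addr0 ?addrA // => x.
case: i j k x ij ik jk => [[|[|[|?]]] ?] [[|[|[|?]]] ?] [[|[|[|?]]] ?] [[|[|[|?]]] ?] //.
Qed.

Lemma ord3_cover (i j k x : 'I_3) : i != j -> i != k -> j != k ->
  [\/ x = i, x = j | x = k].
Proof.
case: (eqVneq x i) => [->|xi] ij ik jk; first by constructor 1.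
case: (eqVneq x j) => [->|xj]; first by constructor 2.
constructor 3; apply: val_inj; move: i j k x ij ik jk xi xj.
by case=> [[|[|[|?]]] ?] [[|[|[|?]]] ?] [[|[|[|?]]] ?] [[|[|[|?]]] ?].
Qed.

(* [u] is a cofactor: it certifies [x = y] modulo the hypothesis [a = b]. *)
Lemma eq_lin (R : comPzRingType) (u a b x y : R) : a = b -> x - y = u * (a - b) -> x = y.
Proof. by move=> ->; rewrite subrr mulr0 => /eqP; rewrite subr_eq0 => /eqP. Qed.
Arguments eq_lin {R} u {a b x y}.

(* [c] is the potential, [f] its dual tensor and [d] lists the eigenvalues of
   the twist; [ht_smooth] is the nondegeneracy of [c]. *)
Record hecke_tensors (L : fieldType) (q : L) (d : 'I_3 -> L)
  (c f : 'I_3 -> 'I_3 -> 'I_3 -> L) : Prop := HeckeTensors {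
  ht_cyc : forall i j k, c i j k = c j k i;
  ht_rot : forall x y z, d x * f x y z = f z x y;
  ht_inv : forall i j k, d i * d j * d k * c i j k = c i j k;
  ht_bigon : forall i u,
    \sum_m \sum_n c i m n * f m n u = (1 + q) * (i == u)%:R;
  ht_square : forall l v r u,
    \sum_m \sum_n \sum_j \sum_k c l m n * f n v j * c r j k * f m k u
    = q * ((r == v)%:R * (l == u)%:R + d v * (l == v)%:R * (r == u)%:R);
  ht_smooth : forall x : 'I_3 -> L,
    (forall k, \sum_i \sum_j x i * x j * c i j k = 0) -> forall i, x i = 0;
  ht_d : forall i, d i != 0;
  ht_tr : q * \sum_i d i = 1 + q + q ^+ 2;
  ht_trV : q * \sum_i (d i)^-1 = 1 + q + q ^+ 2 }.

Section Eigen.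
Variables (L : fieldType) (q : L) (d : 'I_3 -> L).
Variables (c f : 'I_3 -> 'I_3 -> 'I_3 -> L).
Hypotheses (H : hecke_tensors q d c f) (q0 : q != 0).
Hypotheses (two0 : (2%:R : L) != 0) (three0 : (3%:R : L) != 0).

Lemma c_eq0 i j k : d i * d j * d k != 1 -> c i j k = 0.
Proof.
move=> h; have := ht_inv H i j k; move/eqP; rewrite -subr_eq0.
rewrite -{2}[c i j k]mul1r -mulrBl mulf_eq0 subr_eq0 (negbTE h) /=.
by move/eqP.
Qed.

(** Three rotations return to the same entry of f and collect the factor d_i d_j d_k. *)
Lemma f_eq0 i j k : d i * d j * d k != 1 -> f i j k = 0.
Proof.
move=> h; have e : d i * d j * d k * f i j k = f i j k.
  rewrite -[RHS](ht_rot H) -[f j k i](ht_rot H) -[f k i j](ht_rot H); ring.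
move/eqP: e; rewrite -subr_eq0.
rewrite -{2}[f i j k]mul1r -mulrBl mulf_eq0 subr_eq0 (negbTE h) /=.
by move/eqP.
Qed.

(** A rewrite system that picks one representative in each cyclic class of entries, so that the
    expanded equations become polynomials in independent unknowns. *)
Lemma cyc_canon i j k :
  ((c i j i = c i i j) * (c j i i = c i i j) * (c i k i = c i i k) * (c k i i = c i i k)
  * (c j i j = c j j i) * (c i j j = c j j i) * (c j k j = c j j k) * (c k j j = c j j k)
  * (c k i k = c k k i) * (c i k k = c k k i) * (c k j k = c k k j) * (c j k k = c k k j)
  * (c j k i = c i j k) * (c k i j = c i j k) * (c k j i = c i k j) * (c j i k = c i k j))%type.
Proof.
by do !split; first [exact: (ht_cyc H) | by rewrite (ht_cyc H)
  | by rewrite (ht_cyc H) (ht_cyc H)].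
Qed.

End Eigen.

Lemma closed_isotropic (L : closedFieldType) (a b e : L) :
  exists x y : L, a * x ^+ 2 + b * x * y + e * y ^+ 2 = 0 /\ ~ (x = 0 /\ y = 0).
Proof.
have [->|a0] := eqVneq a 0.
  exists 1, 0; split; first by ring.
  by case=> /eqP; rewrite oner_eq0.
pose p : {poly L} := a *: 'X^2 + b *: 'X + e%:P.
have sp : size p = 3%N.
  rewrite /p -addrA size_polyDl size_scale ?size_polyXn //.
  apply: leq_ltn_trans (size_polyD _ _) _; rewrite gtn_max.
  rewrite (leq_ltn_trans (size_scale_leq _ _)) ?size_polyX //=.
  by rewrite (leq_ltn_trans (size_polyC_leq1 _)).
have /closed_rootP [x] : size p != 1%N by rewrite sp.
rewrite rootE /p !hornerE => /eqP /= px; exists x, 1; split.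
  by rewrite -[RHS]px; ring.
by case=> _ /eqP; rewrite oner_eq0.
Qed.

(** * Constraints on the spectrum from nondegeneracy and the traces *)

Section Distinct.
Variables (L : closedFieldType) (q : L) (d : 'I_3 -> L).
Variables (c f : 'I_3 -> 'I_3 -> 'I_3 -> L).
Hypotheses (H : hecke_tensors q d c f) (q0 : q != 0).
Hypotheses (two0 : (2%:R : L) != 0) (three0 : (3%:R : L) != 0).
Variables i j k : 'I_3.
Hypotheses (ij : i != j) (ik : i != k) (jk : j != k).

Let eqsF := (negbTE ij, negbTE ik, negbTE jk).
Let eqsF' : ((j == i) = false) * ((k == i) = false) * ((k == j) = false).
Proof. by do !split; rewrite eq_sym ?eqsF. Qed.
Let eqb := (eqsF, eqsF', eqxx).
Let ce := cyc_canon H i j k.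

Lemma smooth3 (x y z : L) :
  let Q t := x ^+ 2 * c i i t + y ^+ 2 * c j j t + z ^+ 2 * c k k t
    + x * y * (c i j t + c j i t) + x * z * (c i k t + c k i t)
    + y * z * (c j k t + c k j t) in
  Q i = 0 -> Q j = 0 -> Q k = 0 -> [/\ x = 0, y = 0 & z = 0].
Proof.
move=> Q Qi Qj Qk.
pose X t := if t == i then x else if t == j then y else z.
have h : forall t, X t = 0.
  apply: (ht_smooth H) => t.
  transitivity (Q t); last by case: (ord3_cover t ij ik jk) => ->.
  by rewrite !(sum3 _ ij ik jk) /X !eqb /Q; ring.
by have := (h i, h j, h k); rewrite /X !eqb => -[[]].
Qed.

Lemma c_ii_neq0 : c i i i = 0 -> c i i j = 0 -> c i i k = 0 -> False.
Proof.
move=> h1 h2 h3.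
have [] := @smooth3 1 0 0.
- by rewrite h1; ring.
- by rewrite h2; ring.
- by rewrite h3; ring.
by move/eqP; rewrite oner_eq0.
Qed.

(** If d_i^3 differs from 1, c vanishes on the plane of e_i and e_j. For x in this plane only the
    e_k component of c(x, x, _) is left, a binary quadratic form, and its nontrivial zero over a
    closed field contradicts nondegeneracy. *)
Lemma eq_eigen_cube : d i = d j -> d i ^+ 3 = 1.
Proof.
move=> dij; apply/eqP/negPn/negP => h3.
have z a b e : d a = d i -> d b = d i -> d e = d i -> c a b e = 0.
  by move=> da db de; apply: (c_eq0 H); rewrite da db de -expr2 -exprSr.
have [x [y [hxy nz]]] := closed_isotropic (c i i k) (c i j k + c j i k) (c j j k).
have [] := @smooth3 x y 0.
- by rewrite (z i i i) // (z j j i) // (z i j i) // (z j i i) //; ring.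
- by rewrite (z i i j) // (z j j j) // (z i j j) // (z j i j) //; ring.
- by rewrite -[RHS]hxy; ring.
by move=> *; apply: nz.
Qed.

(** Eliminates q between the two trace conditions. *)
Lemma trace_eq : d i + d j + d k = (d i)^-1 + (d j)^-1 + (d k)^-1.
Proof.
apply: (mulfI q0); rewrite -!(sum3 _ ij ik jk).
by rewrite (ht_tr H) -(ht_trV H) (sum3 _ ij ik jk).
Qed.

Lemma inv_cube (x : L) : x ^+ 3 = 1 -> x^-1 = x ^+ 2.
Proof.
move=> x3; have x0 : x != 0 by apply: contra_eq_neq x3 => ->; rewrite expr0n eq_sym oner_neq0.
by apply: (mulfI x0); rewrite divff // -x3; ring.
Qed.

Lemma cube_eq1_N (x : L) : x ^+ 3 = 1 -> x ^+ 2 - x + 1 = 0 -> False.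
Proof.
move=> x3 h; move/eqP: two0; apply.
transitivity (x ^+ 3 + 1); first by rewrite x3.
by transitivity ((x + 1) * (x ^+ 2 - x + 1)); [ring | rewrite h mulr0].
Qed.

Lemma all_eigen_eq : d i = d j -> d i = d k -> d i = 1 /\ q = 1.
Proof.
move=> dij dik; have l3 := eq_eigen_cube dij.
have l0 := ht_d H i.
have l2 : d i ^+ 2 = 1.
  apply: (mulfI three0); rewrite mulr1.
  have := trace_eq; rewrite -dij -dik => e.
  transitivity (d i * (d i + d i + d i)); first by ring.
  by rewrite e !mulrDr divff //; ring.
have l1 : d i = 1 by rewrite -l3 exprS l2 mulr1.
(* With spectrum (1, 1, 1) the trace condition is 3 q = 1 + q + q^2, that is (q - 1)^2 = 0. *)
split=> //; have := ht_tr H; rewrite (sum3 _ ij ik jk) -dij -dik l1 => e.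
apply/eqP; rewrite -subr_eq0 -sqrf_eq0; apply/eqP.
transitivity (1 + q + q ^+ 2 - q * (1 + 1 + 1)); first by ring.
by rewrite e subrr.
Qed.

Lemma c_neq0_eigen a b e : c a b e != 0 -> d a * d b * d e = 1.
Proof. by move=> h; apply/eqP; apply: contraNT h => h; rewrite (c_eq0 H). Qed.

(** Nondegeneracy at e_i provides a nonzero c(i, i, .), and invariance turns it into a relation
    between eigenvalues. *)
Lemma eigen_or : [\/ d i ^+ 3 = 1, d i ^+ 2 * d j = 1 | d i ^+ 2 * d k = 1].
Proof.
case: (eqVneq (c i i i) 0) => [c1|/c_neq0_eigen<-]; last by constructor 1; ring.
case: (eqVneq (c i i j) 0) => [c2|/c_neq0_eigen<-]; last by constructor 2; ring.
case: (eqVneq (c i i k) 0) => [c3|/c_neq0_eigen<-]; last by constructor 3; ring.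
by case: (c_ii_neq0 c1 c2 c3).
Qed.

End Distinct.

Section Distinct2.
Variables (L : closedFieldType) (q : L) (d : 'I_3 -> L).
Variables (c f : 'I_3 -> 'I_3 -> 'I_3 -> L).
Hypotheses (H : hecke_tensors q d c f) (q0 : q != 0).
Hypotheses (two0 : (2%:R : L) != 0) (three0 : (3%:R : L) != 0).
Variables i j k : 'I_3.
Hypotheses (ij : i != j) (ik : i != k) (jk : j != k).
Let ji : j != i. Proof. by rewrite eq_sym. Qed.
Let ki : k != i. Proof. by rewrite eq_sym. Qed.
Let kj : k != j. Proof. by rewrite eq_sym. Qed.

Lemma two_eigen_eq : d i = d j -> d i != d k ->
  [/\ d i = 1, d j = 1, d k = -1 & q ^+ 2 = -1].
Proof.
move=> dij dik; have l3 := eq_eigen_cube H ij ik jk dij.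
have l0 := ht_d H i; have m0 := ht_d H k.
have tr := trace_eq H q0 ij ik jk.
(* An arrow from k gives d_k^2 = d_i^2, so d_k = - d_i, and the trace condition collapses to d_i = 1
   / d_i. *)
have eqN : d k ^+ 2 * d i = 1 -> [/\ d i = 1, d j = 1, d k = -1 & q ^+ 2 = -1].
  move=> h; have e : d k = - d i.
    apply/eqP; rewrite -subr_eq0 opprK.
    have: (d k - d i) * (d k + d i) == 0.
      apply/eqP; apply: (mulIf l0); rewrite mul0r.
      by transitivity (d k ^+ 2 * d i - d i ^+ 3); [ring | rewrite h l3 subrr].
    by rewrite mulf_eq0 subr_eq0 eq_sym (negbTE dik).
  have i1 : d i = 1.
    move: tr; rewrite -dij e invrN !addrK => t.
    have i2 : d i ^+ 2 = 1 by rewrite expr2 {2}t divff.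
    by rewrite -l3 exprS i2 mulr1.
  have := ht_tr H; rewrite (sum3 _ ij ik jk) -dij e i1 => tr'.
  split=> //; apply/eqP; rewrite -subr_eq0; apply/eqP.
  transitivity (1 + q + q ^+ 2 - q * (1 + 1 + -1)); first by ring.
  by rewrite tr' subrr.
case: (eigen_or H ki kj ij) => [k3|//|h]; last by apply: eqN; rewrite dij.
(* Now d_k^3 = 1, so d_k / d_i is a primitive cube root of unity. Eliminating d_k between its
   equation and the trace condition leaves 3 d_i^2 (d_i^2 - d_i + 1) = 0. *)
exfalso; apply: (cube_eq1_N two0 l3).
have h : d k ^+ 2 + d k * d i + d i ^+ 2 = 0.
  have: (d k - d i) * (d k ^+ 2 + d k * d i + d i ^+ 2) == 0.
    by apply/eqP; transitivity (d k ^+ 3 - d i ^+ 3); [ring | rewrite k3 l3 subrr].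
  by rewrite mulf_eq0 subr_eq0 eq_sym (negbTE dik) => /eqP.
move: tr; rewrite -dij !inv_cube // => t.
have m : d k * (1 + d i) = d i ^+ 2 - 2%:R * d i.
  transitivity (d i + d i + d k - (d i ^+ 2 + d i ^+ 2 + d k ^+ 2)
     + (d k ^+ 2 + d k * d i + d i ^+ 2) + d i ^+ 2 - 2%:R * d i); first by ring.
  by rewrite h t; ring.
apply: (mulfI three0); rewrite mulr0; apply: (mulfI (expf_neq0 2 l0)); rewrite mulr0.
transitivity ((d k * (1 + d i)) ^+ 2 + (d k * (1 + d i)) * d i * (1 + d i)
   + d i ^+ 2 * (1 + d i) ^+ 2); first by rewrite m; ring.
by transitivity ((1 + d i) ^+ 2 * (d k ^+ 2 + d k * d i + d i ^+ 2));
  [ring | rewrite h mulr0].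
Qed.

End Distinct2.

(** * Excluding nontrivial spectra *)

Section Reflection.
Variables (L : closedFieldType) (q : L) (d : 'I_3 -> L).
Variables (c f : 'I_3 -> 'I_3 -> 'I_3 -> L).
Hypotheses (H : hecke_tensors q d c f) (q0 : q != 0).
Hypotheses (two0 : (2%:R : L) != 0) (three0 : (3%:R : L) != 0).
Variables i j k : 'I_3.
Hypotheses (ij : i != j) (ik : i != k) (jk : j != k).

Let eqsF := (negbTE ij, negbTE ik, negbTE jk).
Let eqsF' : ((j == i) = false) * ((k == i) = false) * ((k == j) = false).
Proof. by do !split; rewrite eq_sym ?eqsF. Qed.
Let eqb := (eqsF, eqsF', eqxx).
Let ce := cyc_canon H i j k.

(** The hypothesis [c i k k = 0] confines c(i, ., .) to the plane of e_i and e_j, where its matrix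
    is M = [[x, y], [y, z]]. Let N = [[F, G], [G, E]] and N' = [[G, E], [E, K]] be the matrices
    there of f(., ., i) and f(., ., j). The contradiction is found among M, N, N', the scalar g =
    c_kkj and the vector w = M (f_ikk, f_jkk). *)
Lemma no_reflection :
  d i = 1 -> d j = 1 -> d k = -1 -> c i k k = 0 -> False.
Proof.
move=> di dj dk cikk.
have n1 : (-1 : L) != 1.
  by rewrite -subr_eq0 -opprD oppr_eq0; exact: two0.
have cz : (c i i k = 0) * (c j j k = 0) * (c i j k = 0) * (c i k j = 0)
   * (c k k k = 0) * (c k k i = 0).
  do !split; last (by rewrite -cikk ce);
    by apply: (c_eq0 H); rewrite ?di ?dj ?dk ?mulr1 ?mul1r ?mulrN ?mulr1 ?opprK ?mul1r.
have fz : (f i i k = 0) * (f j j k = 0) * (f i j k = 0) * (f i k j = 0)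
   * (f k k k = 0) * (f i k i = 0) * (f k i i = 0) * (f j k j = 0) * (f k j j = 0)
   * (f j k i = 0) * (f j i k = 0) * (f k i j = 0) * (f k j i = 0).
  by do !split; apply: (f_eq0 H); rewrite ?di ?dj ?dk ?mulr1 ?mul1r ?mulrN ?mulr1 ?opprK ?mul1r.
have roti a b : f i a b = f b i a by rewrite -[RHS](ht_rot H) di mul1r.
have rotj a b : f j a b = f b j a by rewrite -[RHS](ht_rot H) dj mul1r.
have rotk a b : - f k a b = f b k a by rewrite -[RHS](ht_rot H) dk mulN1r.
have fc : (f i j i = f i i j) * (f j i i = f i i j) * (f j i j = f j j i)
   * (f i j j = f j j i) * (f k i k = f i k k) * (f k j k = f j k k)
   * (f k k i = - f i k k) * (f k k j = - f j k k).
  have e1 : f i j i = f i i j by rewrite roti.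
  have e2 : f j i j = f j j i by rewrite rotj.
  do !split => //; first [by rewrite rotj | by rewrite roti
    | by rewrite roti -rotk opprK | by rewrite rotj -rotk opprK
    | by rewrite -rotk; congr (- _); rewrite roti | by rewrite -rotk; congr (- _); rewrite rotj | idtac].
have qq : q ^+ 2 = -1.
  have := ht_tr H; rewrite (sum3 _ ij ik jk) di dj dk => e.
  by apply: (eq_lin 1 (esym e)); ring.
have bii := ht_bigon H i i; have bij := ht_bigon H i j.
have si := ht_square H k k i i; have sj := ht_square H k k i j.
have sii := ht_square H i i i i; have sd := ht_square H i j i j.
move: bii bij si sj sii sd.
rewrite !(sum3 _ ij ik jk) !eqb !ce !cz !fc !fz ?di ?dj ?dk /=.
move: (c i i i) (c i i j) (c j j i) (c k k j) (f i i i) (f i i j) (f j j i) (f j j j)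
  (f i k k) (f j k k) (@c_ii_neq0 _ _ _ _ _ H i j k ij ik jk) => x y z g F G E K f1 f2 sm.
move=> bii bij si sj sii sd.
pose w1 := x * f1 + y * f2; pose w2 := y * f1 + z * f2.
have b : x * G + 2%:R * y * E + z * K = 0 by apply: (eq_lin 1 bij); ring.
have m1 : g * (w1 * G + w2 * E) = q by rewrite /w1 /w2; apply: (eq_lin (-1) si); ring.
have m2 : g * (w1 * E + w2 * K) = 0 by rewrite /w1 /w2; apply: (eq_lin (-1) sj); ring.
(* For a 2 x 2 matrix A, (tr A)^2 - tr A^2 = 2 det A. With A = M N the bigon gives tr A = 1 + q, the
   square gives tr A^2 = 2 q, and (1 + q)^2 = 2 q because q^2 = -1. With A = M N' both traces are 0,
   which gives [d2]. *)
have d1 : (x * z - y ^+ 2) * (F * E - G ^+ 2) = 0.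
  apply: (mulfI two0); rewrite mulr0.
  have t1 : x * F + 2%:R * y * G + z * E = 1 + q by apply: (eq_lin 1 bii); ring.
  transitivity ((x * F + 2%:R * y * G + z * E) ^+ 2 - 2%:R * q); last by rewrite t1 sqrrD qq; ring.
  by apply: (eq_lin (-1) sii); ring.
have d2 : (x * z - y ^+ 2) * (G * K - E ^+ 2) = 0.
  apply: (mulfI two0); rewrite mulr0.
  transitivity ((x * G + 2%:R * y * E + z * K) ^+ 2); last by rewrite b expr0n.
  by apply: (eq_lin (-1) sd); ring.
have g0 : g != 0 by apply: contra_eq_neq m1 => ->; rewrite mul0r eq_sym.
have m3 : w1 * E + w2 * K = 0 by apply: (mulfI g0); rewrite m2 mulr0.
have m0 : w1 * G + w2 * E != 0 by apply: contra_eq_neq m1 => ->; rewrite mulr0 eq_sym.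
(* If M is singular, w is proportional to its first row (x, y); then [m3] and the vanishing of tr (M
   N') give (x, y) N' = 0, against [m0]. *)
have [D0|D0] := eqVneq (x * z - y ^+ 2) 0.
  have xw : x * w2 = y * w1.
    by rewrite /w1 /w2; apply: (eq_lin f2 D0); ring.
  have [x0|x0] := eqVneq x 0.
    apply: sm; rewrite ?cz //; apply/eqP; rewrite -sqrf_eq0 -oppr_eq0; apply/eqP.
    by rewrite -D0 x0; ring.
  have e1 : w1 * (x * E + y * K) = 0.
    transitivity (x * (w1 * E + w2 * K)); last by rewrite m3 mulr0.
    by apply: (eq_lin (- K) xw); ring.
  have e2 : w1 * (x * G + y * E) = x * (w1 * G + w2 * E).
    by apply: (eq_lin (- E) xw); ring.
  have w10 : w1 != 0.
    apply: contra_neq m0 => w0; apply: (mulfI x0).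
    by rewrite -e2 w0 mul0r mulr0.
  have e3 : x * E + y * K = 0 by apply: (mulfI w10); rewrite e1 mulr0.
  have e4 : x * G + y * E = 0.
    apply: (mulfI x0); rewrite mulr0.
    apply: (eq_lin x b); apply/eqP; rewrite -subr_eq0; apply/eqP.
    transitivity (- y * (x * E + y * K) - K * (x * z - y ^+ 2)); first by ring.
    by rewrite e3 D0; ring.
  by move: e2; rewrite e4 mulr0 => /esym /eqP; rewrite mulf_eq0 (negbTE x0) (negbTE m0).
(* If M is invertible, N and N' are singular; with [m3] this makes K, then E, then G vanish. *)
have GK : G * K - E ^+ 2 = 0 by apply: (mulfI D0); rewrite d2 mulr0.
have FE : F * E - G ^+ 2 = 0 by apply: (mulfI D0); rewrite d1 mulr0.
have K0 : K = 0.
  apply: (mulIf m0); rewrite mul0r.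
  transitivity (w1 * (G * K - E ^+ 2) + E * (w1 * E + w2 * K)); first by ring.
  by rewrite GK m3; ring.
have E0 : E = 0.
  apply/eqP; rewrite -sqrf_eq0 -oppr_eq0; apply/eqP; rewrite -GK K0; ring.
have G0 : G = 0.
  apply/eqP; rewrite -sqrf_eq0 -oppr_eq0; apply/eqP; rewrite -FE E0; ring.
by move/eqP: m0; apply; rewrite G0 E0; ring.
Qed.

End Reflection.

Section Simple.
Variables (L : closedFieldType) (q : L) (d : 'I_3 -> L).
Variables (c f : 'I_3 -> 'I_3 -> 'I_3 -> L).
Hypotheses (H : hecke_tensors q d c f) (q0 : q != 0).
Hypotheses (two0 : (2%:R : L) != 0) (three0 : (3%:R : L) != 0).

Lemma tensor0 a b e : d a * d b * d e <> 1 ->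
  ((c a b e = 0) * (c a e b = 0) * (c b a e = 0) * (c b e a = 0) * (c e a b = 0)
   * (c e b a = 0) * (f a b e = 0) * (f a e b = 0) * (f b a e = 0) * (f b e a = 0)
   * (f e a b = 0) * (f e b a = 0))%type.
Proof.
by move=> h; do !split; first [apply: (c_eq0 H) | apply: (f_eq0 H)]; apply/eqP;
  apply: contra_not h => <-; ring.
Qed.

Variables i j k : 'I_3.
Hypotheses (ij : i != j) (ik : i != k) (jk : j != k).
Hypotheses (dij : d i <> d j) (dik : d i <> d k) (djk : d j <> d k).

Let eqsF := (negbTE ij, negbTE ik, negbTE jk).
Let eqsF' : ((j == i) = false) * ((k == i) = false) * ((k == j) = false).
Proof. by do !split; rewrite eq_sym ?eqsF. Qed.
Let eqb := (eqsF, eqsF', eqxx).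
Let ce := cyc_canon H i j k.
Let dj0 := ht_d H j.

Lemma mul_eq1_inj (a b x : L) : a * x = 1 -> b * x = 1 -> a = b.
Proof.
move=> h1 h2; transitivity (a * (b * x)); first by rewrite h2 mulr1.
by transitivity (b * (a * x)); [ring | rewrite h1 mulr1].
Qed.

(** The hypotheses force d_i = - d_j, d_k = 1 and q^2 = -1, and c_iij is, up to rotation, the only
    surviving entry of c with an index i. With C and F its value and the dual one, bigon and square
    at i give C F d_i = 1 + q and (C F d_i)^2 = q, whereas (1 + q)^2 = 2 q. *)
Lemma no_involution : d i ^+ 2 * d j = 1 -> d j ^+ 3 = 1 -> d k ^+ 3 = 1 -> False.
Proof.
move=> hi hj hk.
have e : d i = - d j.
  apply/eqP; rewrite -subr_eq0 opprK.
  have: (d i - d j) * (d i + d j) == 0.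
    apply/eqP; apply: (mulIf dj0); rewrite mul0r.
    by apply: (eq_lin 1 (etrans hi (esym hj))); ring.
  by rewrite mulf_eq0 subr_eq0 => /orP [/eqP //|].
have tr := trace_eq H q0 ij ik jk.
have k1 : d k = 1.
  have k2 : d k ^+ 2 = 1.
    move: tr; rewrite e invrN !addNr !add0r => t; by rewrite expr2 {2}t divff ?(ht_d H).
  by rewrite -hk exprS k2 mulr1.
have qq : q ^+ 2 = -1.
  have := ht_tr H; rewrite (sum3 _ ij ik jk) e k1 addNr add0r => t.
  by apply: (eq_lin 1 (esym t)); ring.
have jj : d j ^+ 2 + d j + 1 = 0.
  have j1 : d j - 1 != 0 by rewrite subr_eq0; apply/eqP; rewrite -k1.
  by apply: (mulfI j1); rewrite mulr0; apply: (eq_lin 1 hj); ring.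
have z1 : d i * d i * d i <> 1.
  by move=> h; apply: dij; apply: (@mul_eq1_inj _ _ (d i * d i)); [rewrite -[RHS]h | rewrite -[RHS]hi]; ring.
have z2 : d i * d i * d k <> 1.
  by move=> h; apply: djk; apply: (@mul_eq1_inj _ _ (d i * d i)); [rewrite -[RHS]hi | rewrite -[RHS]h]; ring.
have z3 : d j * d j * d i <> 1.
  by move=> h; apply: dij; apply: (@mul_eq1_inj _ _ (d j * d j)); [rewrite -[RHS]h | rewrite -[RHS]hj]; ring.
have z4 : d i * d j * d k <> 1.
  by move=> h; apply: dik; apply: (@mul_eq1_inj _ _ (d i * d j)); [rewrite -[RHS]hi | rewrite -[RHS]h]; ring.
have z5 : d k * d k * d i <> 1 by rewrite k1 !mul1r -k1.
have r1 : f j i i = d i * f i i j by rewrite (ht_rot H).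
have r2 : f i i j = d i * f i j i by rewrite (ht_rot H).
have bi := ht_bigon H i i; have si := ht_square H i i i i.
move: bi si; rewrite !(sum3 _ ij ik jk) !eqb !ce.
rewrite !(tensor0 z1, tensor0 z2, tensor0 z3, tensor0 z4, tensor0 z5) /=.
rewrite r1 r2; move: (c i i j) (f i j i) => C F bi si.
have t1 : C * F * (1 + d i ^+ 2) = 1 + q by apply: (eq_lin 1 bi); ring.
have t2 : (C * F * d i) ^+ 2 * (1 + d i) = q * (1 + d i).
  by apply: (eq_lin 1 si); ring.
have i1 : 1 + d i != 0.
  by rewrite e subr_eq0; apply/eqP => j1; apply: djk; rewrite -j1 k1.
have t3 : (C * F * d i) ^+ 2 = q by apply: (mulIf i1).
have t4 : C * F * d i = 1 + q.
  by rewrite -t1; apply: (eq_lin (- (C * F)) jj); rewrite e; ring.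
move/eqP: q0; apply; rewrite -[q]addr0 -(addrN q) addrA -{3}t3 t4 sqrrD qq; ring.
Qed.

(** Only entries with three equal or three distinct indices survive, and rotation also kills f_jjj
    and f_kkk. Bigon and square at j determine c_ijk f_ijk = q and c_ikj f_ikj = 1; an off-diagonal
    square then equates a product of nonzero factors to 0. *)
Lemma no_cube_roots :
  d i = 1 -> d j = q -> d k = q ^+ 2 -> q ^+ 2 + q + 1 = 0 -> False.
Proof.
move=> di dj dk qq; have q3 : q ^+ 3 = 1 by apply: (eq_lin (q - 1) qq); ring.
have q1 : q <> 1 by move=> h; apply: dij; rewrite di dj h.
have q2 : q ^+ 2 <> 1 by move=> h; apply: dik; rewrite di dk h.
have q4 : q ^+ 4 = q by rewrite exprS q3 mulr1.
have q5 : q ^+ 5 = q ^+ 2 by rewrite -[5%N]/(3 + 2)%N exprD q3 mul1r.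
have z1 : d i * d i * d j <> 1 by rewrite di dj !mul1r.
have z2 : d i * d i * d k <> 1 by rewrite di dk !mul1r.
have z3 : d j * d j * d i <> 1 by rewrite di dj mulr1 -expr2.
have z4 : d j * d j * d k <> 1 by rewrite dj dk -expr2 -exprD q4.
have z5 : d k * d k * d i <> 1 by rewrite di dk mulr1 -exprD q4.
have z6 : d k * d k * d j <> 1 by rewrite dj dk -exprD -exprSr q5.
have zz := (tensor0 z1, tensor0 z2, tensor0 z3, tensor0 z4, tensor0 z5, tensor0 z6).
have fjj : f j j j = 0.
  apply/eqP; have /eqP := ht_rot H j j j; rewrite dj -subr_eq0 -{2}[f j j j]mul1r -mulrBl.
  by rewrite mulf_eq0 subr_eq0 => /orP [/eqP|].
have fkk : f k k k = 0.
  apply/eqP; have /eqP := ht_rot H k k k; rewrite dk -subr_eq0 -{2}[f k k k]mul1r -mulrBl.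
  by rewrite mulf_eq0 subr_eq0 => /orP [/eqP|].
have r1 : f k i j = f i j k by rewrite -(ht_rot H) di mul1r.
have r2 : f j k i = q ^+ 2 * f i j k by rewrite -(ht_rot H) dk r1.
have r3 : f j i k = f i k j by rewrite -(ht_rot H) di mul1r.
have r4 : f k j i = q * f i k j by rewrite -(ht_rot H) dj r3.
have cii : c i i i != 0.
  by apply/eqP => h; apply: (c_ii_neq0 H ij ik jk); rewrite ?zz.
have ckk : c k k k != 0.
  by apply/eqP => h; apply: (@c_ii_neq0 _ _ _ _ _ H k i j); rewrite ?zz // eq_sym.
have bj := ht_bigon H j j; have sj := ht_square H j j j j.
have sk := ht_square H k j i j.
move: bj sj sk cii ckk; rewrite !(sum3 _ ij ik jk) !eqb !ce.
rewrite !zz ?fjj ?fkk ?r4 ?r3 ?r2 ?r1 ?di ?dj ?dk /=.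
move: (c i i i) (c j j j) (c k k k) (c i j k) (c i k j) (f i i i) (f i j k) (f i k j).
move=> ci cj ck a b F P Q bj sj sk ci0 ck0.
have e1 : a * P + b * Q = - q ^+ 2 by apply: (eq_lin 1 bj); apply: (eq_lin 1 qq); ring.
have e2 : a ^+ 2 * P ^+ 2 + q * (b * Q) ^+ 2 = -1.
  by apply: (eq_lin 1 sj); apply: (eq_lin 1 qq); ring.
have bQ : b * Q = - q ^+ 2 - a * P by rewrite -e1; ring.
(* Eliminating b Q between [e1] and [e2] leaves, up to a unit, the perfect square (a P - q)^2. *)
have aP : a * P = q.
  apply/eqP; rewrite -subr_eq0 -sqrf_eq0 -(mulrI_eq0 _ (mulfI (expf_neq0 2 q0))) -oppr_eq0.
  apply/eqP; transitivity (a ^+ 2 * P ^+ 2 + q * (b * Q) ^+ 2 + 1); last by rewrite e2 addNr.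
  rewrite bQ.
  by apply: (eq_lin (- ((a * P) ^+ 2 + q ^+ 3 - q + 1)) qq); ring.
have bQ1 : b * Q = 1 by rewrite bQ aP; apply: (eq_lin (-1) qq); ring.
have P0 : P != 0 by apply: contra_neq q0 => P0; rewrite -aP P0 mulr0.
have Q0 : Q != 0 by apply/eqP => Q0; move/eqP: bQ1; rewrite Q0 mulr0 eq_sym oner_eq0.
have : ck * ci * q * P * Q = 0 by apply: (eq_lin 1 sk); ring.
move/eqP; rewrite !mulf_eq0 (negbTE ck0) (negbTE ci0) (negbTE q0) (negbTE P0).
by rewrite (negbTE Q0).
Qed.

End Simple.

(* The last spectrum: c is a multiple of x^2 y + y^2 z + z^2 x and the
   eigenvalues are primitive ninth roots of unity. *)
Lemma klein_powers (L : fieldType) (x y z : L) :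
  x ^+ 2 * y = 1 -> y ^+ 2 * z = 1 -> z ^+ 2 * x = 1 -> x <> y ->
  [/\ y = x ^+ 7, z = x ^+ 4, x ^+ 9 = 1 & x ^+ 6 + x ^+ 3 + 1 = 0].
Proof.
move=> hx hy hz xy.
have zE : z = x ^+ 4.
  transitivity (z * (x ^+ 2 * y) ^+ 2); first by rewrite hx; ring.
  by transitivity (x ^+ 4 * (y ^+ 2 * z)); [ring | rewrite hy mulr1].
have x9 : x ^+ 9 = 1 by rewrite -hz zE; ring.
have yE : y = x ^+ 7.
  transitivity (y * x ^+ 9); first by rewrite x9 mulr1.
  by transitivity (x ^+ 7 * (x ^+ 2 * y)); [ring | rewrite hx mulr1].
split=> //; have x1 : x ^+ 3 - 1 != 0.
  rewrite subr_eq0; apply/eqP => h; apply: xy; rewrite yE.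
  by transitivity ((x ^+ 3) ^+ 2 * x); [rewrite h; ring | ring].
by apply: (mulfI x1); rewrite mulr0; apply: (eq_lin 1 x9); ring.
Qed.

Section Klein.
Variables (L : closedFieldType) (q : L) (d : 'I_3 -> L).
Variables (c f : 'I_3 -> 'I_3 -> 'I_3 -> L).
Hypotheses (H : hecke_tensors q d c f) (q0 : q != 0).
Hypotheses (two0 : (2%:R : L) != 0) (three0 : (3%:R : L) != 0).

Section Relations.
Variables i j k : 'I_3.
Hypotheses (ij : i != j) (ik : i != k) (jk : j != k).
Hypotheses (dij : d i <> d j) (dik : d i <> d k) (djk : d j <> d k).
Hypotheses (hi : d i ^+ 2 * d j = 1) (hj : d j ^+ 2 * d k = 1) (hk : d k ^+ 2 * d i = 1).

Let eqsF := (negbTE ij, negbTE ik, negbTE jk).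
Let eqsF' : ((j == i) = false) * ((k == i) = false) * ((k == j) = false).
Proof. by do !split; rewrite eq_sym ?eqsF. Qed.
Let eqb := (eqsF, eqsF', eqxx).
Let ce := cyc_canon H i j k.

Let zz : [/\ d i * d i * d i <> 1, d j * d j * d j <> 1, d k * d k * d k <> 1,
  d i * d i * d k <> 1 & [/\ d j * d j * d i <> 1, d k * d k * d j <> 1
  & d i * d j * d k <> 1]].
Proof.
have inj (a b x : L) : x * a = 1 -> x * b = 1 -> a = b.
  by rewrite !(mulrC x); apply: mul_eq1_inj.
split; last split; move=> h.
- by apply: dij; apply: (inj _ _ (d i ^+ 2)) => //; rewrite -h; ring.
- by apply: djk; apply: (inj _ _ (d j ^+ 2)) => //; rewrite -h; ring.
- by apply: dik; apply: (inj _ _ (d k ^+ 2)) => //; rewrite -h; ring.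
- by apply: djk; apply: (inj _ _ (d i ^+ 2)) => //; rewrite -h; ring.
- by apply: dik; apply: (inj _ _ (d j ^+ 2)) => //; rewrite -h; ring.
- by apply: dij; apply: (inj _ _ (d k ^+ 2)) => //; rewrite -h; ring.
- by apply: dik; apply: (inj _ _ (d i * d j)); [rewrite -[RHS]hi | rewrite -[RHS]h]; ring.
Qed.

Let rot : [/\ f i i j = d i * f i j i, f j i i = d i ^+ 2 * f i j i,
  f j j k = d j * f j k j, f k j j = d j ^+ 2 * f j k j &
  (f k k i = d k * f k i k) * (f i k k = d k ^+ 2 * f k i k)].
Proof.
by split; [| | | |split]; rewrite ?expr2 -?mulrA !(ht_rot H).
Qed.

(** The value of the potential along the arrow from a to b times its dual value. This product does
    not change when the eigenvectors are rescaled, and the three relations kept from the bigons and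
    squares involve c and f only through it. *)
Definition bubble a b := c a a b * f a b a.

Lemma klein_relations :
  [/\ bubble i j * (1 + d i ^+ 2) + d k * bubble k i = 1 + q,
      d i ^+ 2 * bubble i j ^+ 2 * (1 + d i) + d k * bubble k i ^+ 2 = q * (1 + d i)
    & bubble j k != 0 -> bubble i j = - bubble k i * (d k ^+ 2 + d j)].
Proof.
have [z1 z2 z3 z4 [z5 z6 z7]] := zz; have [r1 r2 r3 r4 [r5 r6]] := rot.
have z := (tensor0 H z1, tensor0 H z2, tensor0 H z3, tensor0 H z4, tensor0 H z5,
  tensor0 H z6, tensor0 H z7).
have cij : c i i j != 0.
  by apply/eqP => h; apply: (c_ii_neq0 H ij ik jk); rewrite ?z.
have bi := ht_bigon H i i; have si := ht_square H i i i i.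
have sj := ht_square H i j i k.
move: bi si sj cij; rewrite /bubble !(sum3 _ ij ik jk) !eqb !ce.
rewrite !z ?r1 ?r2 ?r3 ?r4 ?r5 ?r6 /=.
move: (c i i j) (c j j k) (c k k i) (f i j i) (f j k j) (f k i k) => C1 C2 C3 F1 F2 F3.
move=> bi si sj C10; split.
- by apply: (eq_lin 1 bi); ring.
- by apply: (eq_lin 1 si); ring.
(* The square at (i, j, i, k) carries the common factor C1 F2 d_j, which has to be cancelled. *)
move=> CF2; have F20 : F2 != 0 by apply: contra_neq CF2 => ->; rewrite mulr0.
apply: (mulIf F20); apply: (mulIf (ht_d H j)); apply: (mulIf C10).
by apply: (eq_lin 1 sj); ring.
Qed.

Lemma klein_neqN1 : 1 + d i != 0.
Proof.
apply/eqP => h; have di : d i = -1 by apply: (eq_lin 1 h); ring.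
move/eqP: two0; apply.
have dj : d j = 1 by rewrite -hi di; ring.
have dk : d k = 1 by rewrite -hj dj; ring.
by apply: (eq_lin (-1) hk); rewrite di dk; ring.
Qed.

End Relations.

Section Vanishing.
Variables i j k : 'I_3.
Hypotheses (ij : i != j) (ik : i != k) (jk : j != k).
Hypotheses (dij : d i <> d j) (dik : d i <> d k) (djk : d j <> d k).
Hypotheses (hi : d i ^+ 2 * d j = 1) (hj : d j ^+ 2 * d k = 1) (hk : d k ^+ 2 * d i = 1).
Let ji : j != i. Proof. by rewrite eq_sym. Qed.
Let ki : k != i. Proof. by rewrite eq_sym. Qed.
Let kj : k != j. Proof. by rewrite eq_sym. Qed.

Let djE : d j = d i ^+ 7. Proof. by case: (klein_powers hi hj hk dij). Qed.
Let dkE : d k = d i ^+ 4. Proof. by case: (klein_powers hi hj hk dij). Qed.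
Let di9 : d i ^+ 9 = 1. Proof. by case: (klein_powers hi hj hk dij). Qed.
Let phi : d i ^+ 6 + d i ^+ 3 + 1 = 0. Proof. by case: (klein_powers hi hj hk dij). Qed.

Lemma klein_q : q ^+ 2 + q + 1 = 0.
Proof.
have := ht_tr H; rewrite (sum3 _ ij ik jk) djE dkE => h.
by apply: (eq_lin (- 1) h); apply: (eq_lin (q * d i) phi); ring.
Qed.

(** If it vanished, the square at j would make [bubble i j] nonzero, the third relation at j would
    then force [bubble k i = 0], and the square at k would read 0 = q (1 + d_k). *)
Lemma bubble_neq0 : bubble j k != 0.
Proof.
have [_ _ r3] := klein_relations jk ji ki djk (nesym dij) (nesym dik) hj hk hi.
have [_ r2 _] := klein_relations jk ji ki djk (nesym dij) (nesym dik) hj hk hi.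
have [_ r2' _] := klein_relations ki kj ij (nesym dik) (nesym djk) dij hk hi hj.
have nj := klein_neqN1 hj hk hi; have nk := klein_neqN1 hk hi hj.
apply/eqP => U0.
have Ui : bubble i j != 0.
  apply/eqP => Ui; move: r2; rewrite U0 Ui !expr0n !mulr0 mul0r addr0 => /esym /eqP.
  by rewrite mulf_eq0 (negbTE q0) (negbTE nj).
have Uk : bubble k i == 0.
  apply/negPn/negP => /r3; rewrite U0 => /esym /eqP.
  have -> : d i ^+ 2 + d k = d k * (1 + d j).
    by apply: (eq_lin (- d i ^+ 2) di9); rewrite djE dkE; ring.
  by rewrite !mulf_eq0 oppr_eq0 (negbTE Ui) (negbTE nj) (negbTE (ht_d H k)).
move: r2'; rewrite U0 (eqP Uk) !expr0n !mulr0 mul0r addr0 => /esym /eqP.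
by rewrite mulf_eq0 (negbTE q0) (negbTE nk).
Qed.

(** With U = [bubble k i], eliminating [bubble i j] leaves 3 d_i^8 U^2 = q and U d_i^4 (2 - d_i^4 -
    d_i^5) = 1 + q, where (1 + q)^2 = q by [klein_q]. *)
Lemma klein_norm : (2%:R - d i ^+ 4 - d i ^+ 5) ^+ 2 = 3%:R :> L.
Proof.
have [e1 e2 /(_ bubble_neq0) e3] := klein_relations ij ik jk dij dik djk hi hj hk.
have n := klein_neqN1 hi hj hk; have qq := klein_q.
move: (bubble k i) e1 e2 e3 => U; rewrite dkE djE => e1 e2 e3.
rewrite e3 in e1 e2.
have u2 : 3%:R * d i ^+ 8 * U ^+ 2 = q.
  apply: (mulIf n); apply: (eq_lin 1 e2).
  apply: (eq_lin (- U ^+ 2 * d i) phi).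
  apply: (eq_lin (- U ^+ 2 * (d i ^+ 7 + 3%:R * d i ^+ 8 + 3%:R * d i ^+ 9 + d i ^+ 10 + d i)) di9).
  ring.
have u1 : U * d i ^+ 4 * (2%:R - d i ^+ 4 - d i ^+ 5) = 1 + q.
  apply: (eq_lin 1 e1); apply: (eq_lin (U * d i) phi).
  by apply: (eq_lin (U * d i) di9); ring.
apply: (mulfI q0).
transitivity (3%:R * (U * d i ^+ 4 * (2%:R - d i ^+ 4 - d i ^+ 5)) ^+ 2).
  by rewrite -{1}u2; ring.
by rewrite u1; apply: (eq_lin 3%:R qq); ring.
Qed.

End Vanishing.

(** Apply [klein_norm] at the three vertices. The sums z^m + z^(-m) for a primitive ninth root of
    unity z and m = 1, 2, 4 are the roots of t^3 - 3 t + 1; they have sum 0 and sum of squares 6. So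
    the three values (2 - t)^2 add up to 18, but also to 9. *)
Lemma no_klein (i j k : 'I_3) : i != j -> i != k -> j != k ->
  d i <> d j -> d i <> d k -> d j <> d k ->
  d i ^+ 2 * d j = 1 -> d j ^+ 2 * d k = 1 -> d k ^+ 2 * d i = 1 -> False.
Proof.
move=> ij ik jk dij dik djk hi hj hk.
have ji : j != i by rewrite eq_sym.
have ki : k != i by rewrite eq_sym.
have kj : k != j by rewrite eq_sym.
have n1 := klein_norm ij ik jk dij dik djk hi hj hk.
have n2 := klein_norm jk ji ki djk (nesym dij) (nesym dik) hj hk hi.
have n3 := klein_norm ki kj ij (nesym dik) (nesym djk) dij hk hi hj.
have [djE dkE x9 phi] := klein_powers hi hj hk dij.
have r n m : d i ^+ (n * 9 + m) = d i ^+ m.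
  by rewrite exprD mulnC exprM x9 expr1n mul1r.
move: n2 n3; rewrite djE dkE -!exprM.
(* The exponents 28, 35, 16 and 20 are reduced modulo 9. *)
rewrite (r 3%N 1%N) (r 3%N 8%N) (r 1%N 7%N) (r 2%N 2%N) => n2 n3.
have : 3%:R * 3%:R = 0 :> L.
  transitivity ((2%:R - d i ^+ 4 - d i ^+ 5) ^+ 2 + (2%:R - d i ^+ 1 - d i ^+ 8) ^+ 2
    + (2%:R - d i ^+ 7 - d i ^+ 2) ^+ 2 - 3%:R * 3%:R); last by rewrite n1 n2 n3; ring.
  apply: (eq_lin (- (6%:R + d i ^+ 7 + d i ^+ 5 + d i)) x9).
  by apply: (eq_lin (3%:R * d i + 3%:R * d i ^+ 2) phi); ring.
by move/eqP; rewrite mulf_eq0 (negbTE three0).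
Qed.
End Klein.

(** * Combining the exclusions *)

Section Classification.
Variables (L : closedFieldType) (q : L) (d : 'I_3 -> L).
Variables (c f : 'I_3 -> 'I_3 -> 'I_3 -> L).
Hypotheses (H : hecke_tensors q d c f) (q0 : q != 0).
Hypotheses (two0 : (2%:R : L) != 0) (three0 : (3%:R : L) != 0).

(** Extends [no_involution] to arbitrary d_k. An arrow from k to i would give d_k^2 = 1, hence d_j =
    -1; an arrow from k to j would give d_k^2 = d_i^2, hence d_k = d_i or d_k = - d_i = d_j. *)
Lemma no_involution' (i j k : 'I_3) : i != j -> i != k -> j != k ->
  d i <> d j -> d i <> d k -> d j <> d k ->
  d i ^+ 2 * d j = 1 -> d j ^+ 3 = 1 -> False.
Proof.
move=> ij ik jk dij dik djk hi hj.
have ki : k != i by rewrite eq_sym.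
have kj : k != j by rewrite eq_sym.
have e : d i = - d j.
  apply/eqP; rewrite -subr_eq0 opprK.
  have: (d i - d j) * (d i + d j) == 0.
    apply/eqP; apply: (mulIf (ht_d H j)); rewrite mul0r.
    by apply: (eq_lin 1 (etrans hi (esym hj))); ring.
  by rewrite mulf_eq0 subr_eq0 => /orP [/eqP //|].
case: (eigen_or H ki kj ij) => hk.
- exact: (no_involution H q0 ij ik jk).
- have tr := trace_eq H q0 ij ik jk.
  have k2 : d k ^+ 2 = 1.
    move: tr; rewrite e invrN !addNr !add0r => t; by rewrite expr2 {2}t divff // (ht_d H).
  move: hk; rewrite k2 mul1r => i1; move: e; rewrite i1 => j1.
  have jN : d j = -1 by rewrite j1 opprK.
  move/eqP: two0; apply; apply: (eq_lin (-1) hj); rewrite jN; ring.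
have: (d k - d i) * (d k + d i) == 0.
  apply/eqP; apply: (mulIf (ht_d H j)); rewrite mul0r.
  by apply: (eq_lin 1 (etrans hk (esym hi))); ring.
rewrite mulf_eq0 subr_eq0 => /orP [/eqP h|/eqP h]; first by apply: dik; rewrite h.
by apply: djk; apply: (eq_lin (-1) h); rewrite e; ring.
Qed.

(** Follow the arrows. Two opposite arrows force both cubes to be 1, so either some arrow ends at a
    vertex with d^3 = 1, which [no_involution'] excludes, or the arrows form a 3-cycle, which is the
    Klein case. *)
Lemma no_arrow (i j k : 'I_3) : i != j -> i != k -> j != k ->
  d i <> d j -> d i <> d k -> d j <> d k -> d i ^+ 2 * d j = 1 -> False.
Proof.
move=> ij ik jk dij dik djk hi.
have ji : j != i by rewrite eq_sym.
have ki : k != i by rewrite eq_sym.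
have kj : k != j by rewrite eq_sym.
case: (eigen_or H jk ji ki) => hj.
- exact: (no_involution' ij ik jk).
- case: (eigen_or H ki kj ij) => hk.
  + by apply: (no_involution' jk ji ki) => //; apply: nesym.
  + exact: (no_klein H q0 two0 three0 ij ik jk).
  apply: (no_involution' ij ik jk) => //.
  transitivity (d j ^+ 3 * (d k ^+ 2 * d j)); first by rewrite hk mulr1.
  by transitivity ((d j ^+ 2 * d k) ^+ 2); [ring | rewrite hj expr1n].
apply: (no_involution' ij ik jk) => //.
transitivity (d j ^+ 3 * (d i ^+ 2 * d j)); first by rewrite hi mulr1.
by transitivity ((d j ^+ 2 * d i) ^+ 2); [ring | rewrite hj expr1n].
Qed.

Lemma cube_roots_sum (x y z : L) : x ^+ 3 = 1 -> y ^+ 3 = 1 -> z ^+ 3 = 1 ->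
  x <> y -> x <> z -> y <> z -> x + y + z = 0.
Proof.
move=> hx hy hz xy xz yz.
have h1 : x ^+ 2 + x * y + y ^+ 2 = 0.
  apply: (@mulfI _ (x - y)); first by rewrite subr_eq0; apply/eqP.
  by rewrite mulr0; apply: (eq_lin 1 (etrans hx (esym hy))); ring.
have h2 : x ^+ 2 + x * z + z ^+ 2 = 0.
  apply: (@mulfI _ (x - z)); first by rewrite subr_eq0; apply/eqP.
  by rewrite mulr0; apply: (eq_lin 1 (etrans hx (esym hz))); ring.
apply: (@mulfI _ (y - z)); first by rewrite subr_eq0; apply/eqP.
by rewrite mulr0; apply: (eq_lin 1 (etrans h1 (esym h2))); ring.
Qed.

(** Without arrows the spectrum consists of the three cube roots of unity. Its trace is 0, so q is a
    primitive cube root of unity and the spectrum is {1, q, q^2} in some order. *)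
Lemma eigen_not_distinct (i j k : 'I_3) : i != j -> i != k -> j != k ->
  d i <> d j -> d i <> d k -> d j <> d k -> False.
Proof.
move=> ij ik jk dij dik djk.
have ji : j != i by rewrite eq_sym.
have ki : k != i by rewrite eq_sym.
have kj : k != j by rewrite eq_sym.
have dji := nesym dij; have dki := nesym dik; have dkj := nesym djk.
case: (eigen_or H ij ik jk) => [hi|h|h]; last 2 first.
- exact: (no_arrow ij ik jk).
- exact: (no_arrow ik ij kj).
case: (eigen_or H jk ji ki) => [hj|h|h]; last 2 first.
- exact: (no_arrow jk ji ki).
- exact: (no_arrow ji jk ik).
case: (eigen_or H ki kj ij) => [hk|h|h]; last 2 first.
- exact: (no_arrow ki kj ij).
- exact: (no_arrow kj ki ji).
have s := cube_roots_sum hi hj hk dij dik djk.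
have qq : q ^+ 2 + q + 1 = 0.
  have := ht_tr H; rewrite (sum3 _ ij ik jk) s mulr0 => h.
  by apply: (eq_lin (-1) h); ring.
have q3 : q ^+ 3 = 1 by apply: (eq_lin (q - 1) qq); ring.
have q1 : q <> 1.
  by move=> h; move/eqP: three0; apply; rewrite -[RHS]qq h; ring.
have among (w : L) : w ^+ 3 = 1 -> [\/ d i = w, d j = w | d k = w].
  move=> hw; have [<-|/eqP wi] := eqVneq (d i) w; first by constructor 1.
  have [<-|/eqP wj] := eqVneq (d j) w; first by constructor 2.
  have := cube_roots_sum hi hj hw dij wi wj => s'.
  by constructor 3; apply: (eq_lin 1 (etrans s (esym s'))); ring.
have third (a b e : 'I_3) : d a + d b + d e = 0 -> d a = 1 -> d b = q -> d e = q ^+ 2.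
  move=> s' a1 bq; apply: (eq_lin 1 (etrans s' (esym qq))); rewrite a1 bq; ring.
have fin (a b e : 'I_3) : a != b -> a != e -> b != e -> d a <> d b -> d a <> d e ->
    d b <> d e -> d a + d b + d e = 0 -> d a = 1 -> d b = q -> False.
  move=> ab ae be dab dae dbe s' a1 bq.
  exact: (no_cube_roots H q0 ab ae be dab dae a1 bq (third _ _ _ s' a1 bq) qq).
have sP (a b e : 'I_3) : d a + d b + d e = d i + d j + d k -> d a + d b + d e = 0.
  by move=> ->.
case: (among 1 (expr1n _ _)) => h1; case: (among q q3) => hq;
  try (by apply: q1; rewrite -h1 -hq).
- by apply: (fin i j k).
- by apply: (fin i k j) => //; apply: sP; ring.
- by apply: (fin j i k) => //; apply: sP; ring.
- by apply: (fin j k i) => //; apply: sP; ring.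
- by apply: (fin k i j) => //; apply: sP; ring.
- by apply: (fin k j i) => //; apply: sP; ring.
Qed.

Lemma eigen_cases (i j k : 'I_3) : i != j -> i != k -> j != k ->
  (q = 1 /\ forall x, d x = 1)
  \/ exists a b e, [/\ a != b, a != e, b != e, d a = 1 & d b = 1 /\ d e = -1].
Proof.
move=> ij ik jk.
have aux (a b e : 'I_3) : a != b -> a != e -> b != e -> d a = d b ->
    (q = 1 /\ forall x, d x = 1)
  \/ exists a b e, [/\ a != b, a != e, b != e, d a = 1 & d b = 1 /\ d e = -1].
  move=> ab ae be dab; have [dae|dae] := eqVneq (d a) (d e).
    left; have [a1 q1] := all_eigen_eq H q0 three0 ab ae be dab dae.
    by split=> // x; case: (ord3_cover x ab ae be) => ->; rewrite -?dab -?dae.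
  right; exists a, b, e.
  by have [] := two_eigen_eq H q0 two0 three0 ab ae be dab dae.
have [e|/eqP dij] := eqVneq (d i) (d j); first exact: (aux i j k).
have [e|/eqP dik] := eqVneq (d i) (d k).
  by apply: (aux i k j) => //; rewrite eq_sym.
have [e|/eqP djk] := eqVneq (d j) (d k).
  by apply: (aux j k i) => //; rewrite eq_sym.
by case: (eigen_not_distinct ij ik jk dij dik djk).
Qed.

End Classification.

(** * The Sklyanin potential and the untwisted case *)

Definition skl (L : fieldType) (a b c : L) (i m n : 'I_3) : L :=
  a * ((m == i + 1) && (n == i - 1))%:R + b * ((m == i - 1) && (n == i + 1))%:R
  + c * ((m == i) && (n == i))%:R.

Lemma skl_relationsE (L : fieldType) (a b c : L) i m n :
  skl_relations a b c i (mxtens_index (m, n)) = skl a b c i m n.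
Proof. by rewrite mxE !(can_eq (@mxtens_indexK 3 3)) !xpair_eqE. Qed.

Lemma skl_cyc (L : fieldType) (a b c : L) i m n : skl a b c i m n = skl a b c m n i.
Proof.
rewrite /skl; case: i m n => [[|[|[|?]]] ?] [[|[|[|?]]] ?] [[|[|[|?]]] ?] //=.
Qed.

(** Eliminating Z between the last two equations gives a quadratic form in X and Y. Its discriminant
    vanishes thanks to the relations among r, s, t, and r times the form is the square of the
    difference of the two sides. *)
Lemma hesse_ratio (L : fieldType) (X Y Z t r s : L) : s != 0 ->
  s + t + r = 2%:R -> t * r + t * s + r * s = 1 ->
  t ^+ 2 * Y * Z + r ^+ 2 * X * Z + s ^+ 2 * X * Y = 0 ->
  t * r * Z + r * s * X + s * t * Y = 0 -> r ^+ 2 * X = t * (s - 1) * Y.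
Proof.
move=> s0 e1 e2 h3 h4.
have tE : t = 2%:R - s - r by rewrite -e1; ring.
have rt : r * t = (1 - s) ^+ 2 by rewrite tE in e2 *; apply: (eq_lin 1 e2); ring.
have Q0 : X ^+ 2 * r ^+ 3 + Y ^+ 2 * t ^+ 3 + X * Y * r * t * (t + r - s) = 0.
  apply: (mulfI s0); rewrite mulr0; apply: (eq_lin (- (t * r)) h3).
  by apply: (eq_lin (r ^+ 2 * X + t ^+ 2 * Y) h4); ring.
apply/eqP; rewrite -subr_eq0 -sqrf_eq0; apply/eqP.
apply: (eq_lin r Q0); apply: (eq_lin (- t ^+ 2 * Y ^+ 2) rt).
by apply: (eq_lin (- X * Y * r ^+ 2 * t) e1); ring.
Qed.

(** In s = c C, t = a A, r = b B the equations depend on a, b, c only through the cubes X, Y, Z. Two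
    uses of [hesse_ratio] express Y and Z through X, whence t (X + Y + Z) = 3 (t - 1) X and t^3 Y Z
    = (t - 1)^3 X^2; the cube of the first, combined with the second, is the excluded equation. *)
Lemma hesse_parameters (L : fieldType) (a b c A B C : L) :
  (2%:R : L) != 0 -> a * b * c != 0 ->
  c * C + a * A + b * B = 2%:R ->
  (c * C) ^+ 2 + (a * A) ^+ 2 + (b * B) ^+ 2 = 2%:R ->
  b * c * A ^+ 2 + a * c * B ^+ 2 + a * b * C ^+ 2 = 0 ->
  c ^+ 2 * A * B + a ^+ 2 * B * C + b ^+ 2 * A * C = 0 ->
  (a ^+ 3 + b ^+ 3 + c ^+ 3) ^+ 3 != 27%:R * a ^+ 3 * b ^+ 3 * c ^+ 3 -> False.
Proof.
move=> two0 abc0 e1 h2 h3 h4 /eqP; apply.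
pose s := c * C; pose t := a * A; pose r := b * B.
have : [/\ a ^+ 3 != 0, b ^+ 3 != 0 & c ^+ 3 != 0].
  have /and3P [? ? ?] : [&& a != 0, b != 0 & c != 0].
    by rewrite andbA -!negb_or -!mulf_eq0.
  by split; apply: expf_neq0.
have e2 : t * r + t * s + r * s = 1.
  apply: (mulfI two0); apply: (eq_lin (s + t + r + 2%:R) e1).
  by apply: (eq_lin (-1) h2); rewrite /s /t /r; ring.
have i1 : t ^+ 2 * b ^+ 3 * c ^+ 3 + r ^+ 2 * a ^+ 3 * c ^+ 3 + s ^+ 2 * a ^+ 3 * b ^+ 3 = 0.
  by apply: (eq_lin (a ^+ 2 * b ^+ 2 * c ^+ 2) h3); rewrite /s /t /r; ring.
have i2 : t * r * c ^+ 3 + r * s * a ^+ 3 + s * t * b ^+ 3 = 0.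
  by apply: (eq_lin (a * b * c) h4); rewrite /s /t /r; ring.
move: e1; rewrite -/s -/t -/r; move: s t r (a ^+ 3) (b ^+ 3) (c ^+ 3) i1 i2 e2.
move=> s t r X Y Z i1 i2 e2 e1 [X0 Y0 Z0].
have t0 : t != 0.
  apply: contra_neq X0 => t0; move: i2 e2.
  rewrite t0 !mulr0 !mul0r !add0r addr0 => i2 e2.
  by move: i2; rewrite e2 mul1r.
have r0 : r != 0.
  apply: contra_neq Y0 => r0; move: i2 e2; rewrite r0 !mulr0 !mul0r !add0r addr0 => i2 e2.
  by move: i2; rewrite (mulrC s) e2 mul1r.
have s0 : s != 0.
  apply: contra_neq Z0 => s0; move: i2 e2; rewrite s0 !mulr0 !mul0r !addr0 => i2 e2.
  by move: i2; rewrite e2 mul1r.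
have hY := hesse_ratio s0 e1 e2 i1 i2.
have hZ : s ^+ 2 * X = t * (r - 1) * Z.
  apply: (hesse_ratio (Z := Y) r0) => //.
  - by rewrite -[RHS]e1; ring.
  - by rewrite -[RHS]e2; ring.
  - by rewrite -[RHS]i1; ring.
  - by rewrite -[RHS]i2; ring.
have tE : t = 2%:R - s - r by rewrite -e1; ring.
have rt : r * t = (1 - s) ^+ 2 by rewrite tE in e2 *; apply: (eq_lin 1 e2); ring.
have st : s * t = (1 - r) ^+ 2 by rewrite tE in e2 *; apply: (eq_lin 1 e2); ring.
have rs : r * s = (1 - t) ^+ 2 by rewrite tE in e2 *; apply: (eq_lin 1 e2); ring.
have pu : (s - 1) * (r - 1) = t * (t - 1) by rewrite tE in e2 *; apply: (eq_lin 1 e2); ring.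
have t1 : t - 1 != 0.
  have : r * s != 0 by rewrite mulf_eq0 negb_or r0.
  by rewrite rs sqrf_eq0 -opprB oppr_eq0.
have S : t * (X + Y + Z) = 3%:R * (t - 1) * X.
  have n0 : t * (t - 1) != 0 by rewrite mulf_eq0 negb_or t0.
  apply: (mulfI n0); rewrite -pu.
  apply: (eq_lin (- (r - 1)) hY); apply: (eq_lin (- (s - 1)) hZ).
  rewrite tE; rewrite tE in e2.
  by apply: (eq_lin (- X * (r + s - 1)) e2); ring.
have P : t ^+ 3 * (Y * Z) = (t - 1) ^+ 3 * X ^+ 2.
  apply: (mulfI t1).
  transitivity (t ^+ 2 * ((s - 1) * (r - 1)) * Y * Z); first by rewrite pu; ring.
  transitivity ((r * s) ^+ 2 * X ^+ 2); last by rewrite rs; ring.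
  transitivity ((t * (s - 1) * Y) * (t * (r - 1) * Z)); first by ring.
  by rewrite -hY -hZ; ring.
apply: (mulfI (expf_neq0 3 t0)).
transitivity ((t * (X + Y + Z)) ^+ 3); first by ring.
transitivity (27%:R * X * (t ^+ 3 * (Y * Z))); last by ring.
by rewrite S P; ring.
Qed.

Section SklDet.
Variables (L : fieldType) (a b c : L).
Hypotheses (abc0 : a * b * c != 0)
  (skl_gen : (a ^+ 3 + b ^+ 3 + c ^+ 3) ^+ 3 != 27%:R * a ^+ 3 * b ^+ 3 * c ^+ 3).

Let a0 : a != 0. Proof. by move: abc0; rewrite !mulf_eq0 !negb_or => /andP [/andP []]. Qed.
Let b0 : b != 0. Proof. by move: abc0; rewrite !mulf_eq0 !negb_or => /andP [/andP []]. Qed.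
Let c0 : c != 0. Proof. by move: abc0; rewrite !mulf_eq0 !negb_or => /andP []. Qed.

(** If it vanished, a^3 + b^3 + c^3 would equal -3 a b (a + b), whose cube is 27 a^3 b^3 c^3. This
    number governs both the nondegeneracy of the potential and the linear system below. *)
Lemma hesse_smooth : c ^+ 3 + (a + b) ^+ 3 != 0.
Proof.
apply: contra_neq skl_gen => h.
have h1 : a ^+ 3 + b ^+ 3 + c ^+ 3 = - 3%:R * a * b * (a + b).
  by apply: (eq_lin 1 h); ring.
by rewrite h1; apply: (eq_lin (- 27%:R * a ^+ 3 * b ^+ 3) h); ring.
Qed.

Lemma not_all_cubes_eq : ~ (a ^+ 3 = b ^+ 3 /\ b ^+ 3 = c ^+ 3).
Proof. by case=> h1 h2; move/eqP: skl_gen; apply; rewrite h1 h2; ring. Qed.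

Let i0 := @Ordinal 3 0 isT.
Let i1 := @Ordinal 3 1 isT.
Let i2 := @Ordinal 3 2 isT.

Lemma skl_values :
  ((skl a b c i0 i0 i0 = c) * (skl a b c i1 i1 i1 = c) * (skl a b c i2 i2 i2 = c)
   * (skl a b c i0 i1 i2 = a) * (skl a b c i0 i2 i1 = b)
   * (skl a b c i0 i0 i1 = 0) * (skl a b c i0 i0 i2 = 0) * (skl a b c i1 i1 i0 = 0)
   * (skl a b c i1 i1 i2 = 0) * (skl a b c i2 i2 i0 = 0) * (skl a b c i2 i2 i1 = 0))%type.
Proof. by do !split; rewrite /skl /= ?mulr0 ?mulr1 ?addr0 ?add0r. Qed.

(** The system is circulant, with determinant c^3 + (a + b)^3. *)
Lemma cyclic_shift_eq0 (x y z : L) :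
  c * x + (a + b) * y = 0 -> c * y + (a + b) * z = 0 -> c * z + (a + b) * x = 0 -> x = 0.
Proof.
move=> h1 h2 h3; apply: (mulfI hesse_smooth); rewrite mulr0.
apply: (eq_lin (c ^+ 2) h1); apply: (eq_lin (- c * (a + b)) h2).
by apply: (eq_lin ((a + b) ^+ 2) h3); ring.
Qed.

(** The off-diagonal bigons form two circulant systems in the entries of f with exactly two equal
    indices, which therefore vanish; the diagonal bigons make the three f_iii equal. One bigon and
    three squares in the remaining unknowns are the input of [hesse_parameters]. *)
Lemma no_cyclic_dual (d : 'I_3 -> L) (T f : 'I_3 -> 'I_3 -> 'I_3 -> L) :
  (2%:R : L) != 0 -> (forall x, d x = 1) -> (forall i m n, T i m n = skl a b c i m n) ->
  hecke_tensors 1 d T f -> False.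
Proof.
move=> two0 hd hT H.
have e01 : i0 != i1 by []. have e02 : i0 != i2 by []. have e12 : i1 != i2 by [].
have r x y z : f x y z = f z x y by rewrite -[RHS](ht_rot H) hd mul1r.
have fr : (f i0 i1 i0 = f i0 i0 i1) * (f i1 i0 i0 = f i0 i0 i1) * (f i0 i2 i0 = f i0 i0 i2)
   * (f i2 i0 i0 = f i0 i0 i2) * (f i1 i0 i1 = f i1 i1 i0) * (f i0 i1 i1 = f i1 i1 i0)
   * (f i1 i2 i1 = f i1 i1 i2) * (f i2 i1 i1 = f i1 i1 i2) * (f i2 i0 i2 = f i2 i2 i0)
   * (f i0 i2 i2 = f i2 i2 i0) * (f i2 i1 i2 = f i2 i2 i1) * (f i1 i2 i2 = f i2 i2 i1)
   * (f i1 i2 i0 = f i0 i1 i2) * (f i2 i0 i1 = f i0 i1 i2) * (f i2 i1 i0 = f i0 i2 i1)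
   * (f i1 i0 i2 = f i0 i2 i1).
  by do !split; first [exact: r | by rewrite r; exact: r].
have ce := cyc_canon H i0 i1 i2.
have sv := skl_values.
have b00 := ht_bigon H i0 i0; have b11 := ht_bigon H i1 i1; have b22 := ht_bigon H i2 i2.
have b01 := ht_bigon H i0 i1; have b12 := ht_bigon H i1 i2; have b20 := ht_bigon H i2 i0.
have b02 := ht_bigon H i0 i2; have b21 := ht_bigon H i2 i1; have b10 := ht_bigon H i1 i0.
move: b00 b11 b22 b01 b12 b20 b02 b21 b10.
rewrite !(sum3 _ e01 e02 e12) !ce !hT !sv !fr ?hd /= => b00 b11 b22 b01 b12 b20 b02 b21 b10.
have y0 : f i0 i0 i1 = 0.
  apply: (@cyclic_shift_eq0 _ (f i1 i1 i2) (f i2 i2 i0)).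
  - by apply: (eq_lin 1 b01); ring.
  - by apply: (eq_lin 1 b12); ring.
  - by apply: (eq_lin 1 b20); ring.
have y1 : f i1 i1 i2 = 0.
  apply: (@cyclic_shift_eq0 _ (f i2 i2 i0) (f i0 i0 i1)).
  - by apply: (eq_lin 1 b12); ring.
  - by apply: (eq_lin 1 b20); ring.
  - by apply: (eq_lin 1 b01); ring.
have y2 : f i2 i2 i0 = 0.
  apply: (@cyclic_shift_eq0 _ (f i0 i0 i1) (f i1 i1 i2)).
  - by apply: (eq_lin 1 b20); ring.
  - by apply: (eq_lin 1 b01); ring.
  - by apply: (eq_lin 1 b12); ring.
have z0 : f i0 i0 i2 = 0.
  apply: (@cyclic_shift_eq0 _ (f i2 i2 i1) (f i1 i1 i0)).
  - by apply: (eq_lin 1 b02); ring.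
  - by apply: (eq_lin 1 b21); ring.
  - by apply: (eq_lin 1 b10); ring.
have z1 : f i1 i1 i0 = 0.
  apply: (@cyclic_shift_eq0 _ (f i0 i0 i2) (f i2 i2 i1)).
  - by apply: (eq_lin 1 b10); ring.
  - by apply: (eq_lin 1 b02); ring.
  - by apply: (eq_lin 1 b21); ring.
have z2 : f i2 i2 i1 = 0.
  apply: (@cyclic_shift_eq0 _ (f i1 i1 i0) (f i0 i0 i2)).
  - by apply: (eq_lin 1 b21); ring.
  - by apply: (eq_lin 1 b10); ring.
  - by apply: (eq_lin 1 b02); ring.
have f1 : f i1 i1 i1 = f i0 i0 i0.
  by apply: (mulfI c0); apply: (eq_lin 1 (etrans b11 (esym b00))); ring.
have f2 : f i2 i2 i2 = f i0 i0 i0.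
  by apply: (mulfI c0); apply: (eq_lin 1 (etrans b22 (esym b00))); ring.
have s00 := ht_square H i0 i0 i0 i0; have s12 := ht_square H i0 i2 i0 i1.
have s22 := ht_square H i0 i2 i1 i2.
move: b00 s00 s12 s22.
rewrite !(sum3 _ e01 e02 e12) !ce !hT !sv !fr ?hd ?y0 ?y1 ?y2 ?z0 ?z1 ?z2 ?f1 ?f2 /=.
move: (f i0 i0 i0) (f i0 i1 i2) (f i0 i2 i1) => C A B b00 s00 s12 s22.
have h1 : c * C + a * A + b * B = 2%:R by apply: (eq_lin 1 b00); ring.
have h2 : (c * C) ^+ 2 + (a * A) ^+ 2 + (b * B) ^+ 2 = 2%:R.
  by apply: (eq_lin 1 s00); ring.
have h3 : b * c * A ^+ 2 + a * c * B ^+ 2 + a * b * C ^+ 2 = 0.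
  by apply: (eq_lin 1 s12); ring.
have h4 : c ^+ 2 * A * B + a ^+ 2 * B * C + b ^+ 2 * A * C = 0.
  by apply: (eq_lin 1 s22); ring.
exact: (hesse_parameters two0 abc0 h1 h2 h3 h4 skl_gen).
Qed.

End SklDet.

(** * The twist *)

Lemma sum_delta (R : pzRingType) (n : nat) (F : 'I_n -> R) (i : 'I_n) :
  \sum_j F j * (j == i)%:R = F i.
Proof.
rewrite (bigD1 i) //= eqxx mulr1 big1 ?addr0 // => j /negbTE ->.
by rewrite mulr0.
Qed.

Lemma sum_delta' (R : pzRingType) (n : nat) (F : 'I_n -> R) (i : 'I_n) :
  \sum_j F j * (i == j)%:R = F i.
Proof. by rewrite -[RHS]sum_delta; apply: eq_bigr => j _; rewrite eq_sym. Qed.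

Lemma mxtrace_mulE (R : comPzRingType) m n (A : 'M[R]_(m, n)) (B : 'M[R]_(n, m)) :
  \tr (A *m B) = \sum_i \sum_j A i j * B j i.
Proof. by apply: eq_bigr => i _; rewrite mxE. Qed.

Section Web.
Variables (L : fieldType) (q : L) (C G : 'I_3 -> 'M[L]_3) (X X' : 'M[L]_3).

(** The dual tensor is f(m, n, u) = [G u m n]. [Phi] and [Phi'] slice it along its second and first
    index, as [G] does along the third. *)
Definition Phi v : 'M[L]_3 := \matrix_(n, j) G j n v.
Definition Phi' x : 'M[L]_3 := \matrix_(j, p) G j x p.

Hypothesis q0 : q != 0.
Hypothesis C_cyc : forall i m n, C i m n = C m n i.
Hypothesis C_inj : forall x : 'I_3 -> L, \sum_i x i *: C i = 0 -> forall i, x i = 0.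
Hypothesis bigon : forall i u, \tr (C i *m (G u)^T) = (1 + q) * (i == u)%:R.
Hypothesis square : forall l v r u,
  \tr (C l *m Phi v *m C r *m (G u)^T)
  = q * ((r == v)%:R * (l == u)%:R) + (r == u)%:R * X l v.
Hypothesis square' : forall l u r x,
  \tr (C l *m (G u)^T *m C r *m Phi' x)
  = q * ((r == x)%:R * (l == u)%:R) + (r == u)%:R * X' l x.

Let traceE (A B : 'M[L]_3) : \tr (A *m B^T) = \sum_i \sum_j A i j * B i j.
Proof. by rewrite mxtrace_mulE; do 2!apply: eq_bigr => ? _; rewrite mxE. Qed.

(** A gluing identity: after reordering the sums, the left side is the sum over n, k of Y(n, k)
    times the left side of [square] at (n, k, h, n'). *)
Lemma square_complete (Y : 'M[L]_3) n' h :
  \sum_m \sum_j \tr (C m *m Y *m (G j)^T) * (G n' *m (C h)^T) m j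
  = q * Y n' h + (h == n')%:R * \sum_n \sum_k Y n k * X n k.
Proof.
transitivity (\sum_n \sum_k Y n k * \tr (C n *m Phi k *m C h *m (G n')^T)).
  transitivity (\sum_m \sum_j \sum_n \sum_k
      Y n k * ((C n *m Phi k) m j * (G n' *m (C h)^T) m j)).
    apply: eq_bigr => m _; apply: eq_bigr => j _.
    rewrite traceE; under [in RHS]eq_bigr do under eq_bigr do rewrite mulrA.
    under [in RHS]eq_bigr do rewrite -mulr_suml; rewrite -mulr_suml; congr (_ * _).
    transitivity (\sum_p \sum_k \sum_n C m p n * Y n k * G j p k).
      by apply: eq_bigr => p _; apply: eq_bigr => k _; rewrite mxE mulr_suml.
    transitivity (\sum_n \sum_k \sum_p C m p n * Y n k * G j p k).
      rewrite exchange_big [RHS]exchange_big; apply: eq_bigr => k _.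
      by rewrite exchange_big.
    apply: eq_bigr => n _; apply: eq_bigr => k _; rewrite mxE mulr_sumr.
    by apply: eq_bigr => p _; rewrite !mxE -C_cyc; ring.
  under eq_bigr do rewrite exchange_big; rewrite exchange_big; apply: eq_bigr => n _.
  under eq_bigr do rewrite exchange_big; rewrite exchange_big; apply: eq_bigr => k _.
  under eq_bigr do rewrite -mulr_sumr; rewrite -mulr_sumr; congr (_ * _).
  by rewrite -mulmxA -[C h *m _]trmxK traceE trmx_mul trmxK.
under eq_bigr do under eq_bigr do rewrite square mulrDr.
under eq_bigr do rewrite big_split; rewrite big_split; congr (_ + _).
  transitivity (\sum_n (q * Y n h) * (n == n')%:R); last by rewrite sum_delta.
  apply: eq_bigr => n _; rewrite -[q * Y n h](sum_delta' (fun k => q * Y n k)) mulr_suml.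
  by apply: eq_bigr => k _; ring.
rewrite mulr_sumr; apply: eq_bigr => n _; rewrite mulr_sumr.
by apply: eq_bigr => k _; ring.
Qed.

(** Under the hypothesis the left side of [square_complete] is z times a bigon, hence scalar; only q
    Y is left to compare, and q is invertible. *)
Lemma trace_web_scalar (Y : 'M[L]_3) z :
  (forall m j, \tr (C m *m Y *m (G j)^T) = (j == m)%:R * z) -> exists y, Y = y%:M.
Proof.
move=> h; exists (q^-1 * ((1 + q) * z - \sum_n \sum_k Y n k * X n k)).
apply/matrixP => n h'; rewrite !mxE.
have := square_complete Y n h'.
have -> : \sum_m \sum_j \tr (C m *m Y *m (G j)^T) * (G n *m (C h')^T) m j
    = (1 + q) * z * (h' == n)%:R.
  transitivity (z * \tr (C h' *m (G n)^T)); last by rewrite bigon; ring.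
  have -> : \tr (C h' *m (G n)^T) = \tr (G n *m (C h')^T).
    by rewrite -mxtrace_tr trmx_mul trmxK.
  rewrite mulr_sumr; apply: eq_bigr => m _.
  rewrite -(sum_delta (fun j => z * (G n *m (C h')^T) m j)).
  by apply: eq_bigr => j _; rewrite h; ring.
move=> e; apply: (mulfI q0); rewrite -mulrnAr mulrA divff // mul1r -mulr_natr eq_sym.
by rewrite mulrBl e; ring.
Qed.

Definition twist v := \sum_a X a v *: Phi' a - q *: Phi v.

(** By cyclicity of the trace, [square'] applies to the first term of [twist] and [square] to the
    second. Both produce q X(m, v) with l = j, and these cancel. *)
Lemma trace_twist m l j v :
  \tr (C m *m twist v *m C l *m (G j)^T) = (j == m)%:R * ((X' *m X) l v - q ^+ 2 * (l == v)%:R).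
Proof.
have -> : \tr (C m *m twist v *m C l *m (G j)^T)
   = \sum_a X a v * \tr (C l *m (G j)^T *m C m *m Phi' a)
     - q * \tr (C m *m Phi v *m C l *m (G j)^T).
  rewrite mulmxBr !mulmxBl raddfB /= -scalemxAr -!scalemxAl mxtraceZ; congr (_ - _).
  rewrite mulmx_sumr !mulmx_suml raddf_sum; apply: eq_bigr => a _ /=.
  rewrite -scalemxAr -!scalemxAl mxtraceZ; congr (_ * _).
  by rewrite -(mulmxA (C m *m Phi' a)) mxtrace_mulC !mulmxA.
rewrite square; under eq_bigr do rewrite square' mulrDr.
rewrite big_split /= mxE.
have -> : \sum_a X a v * (q * ((m == a)%:R * (l == j)%:R)) = q * (l == j)%:R * X m v.
  by rewrite -(sum_delta' (X ^~ v) m) mulr_sumr; apply: eq_bigr => a _; ring.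
have -> : \sum_a X a v * ((m == j)%:R * X' l a) = (m == j)%:R * \sum_a X' l a * X a v.
  by rewrite mulr_sumr; apply: eq_bigr => a _; ring.
by rewrite (eq_sym m j); ring.
Qed.

Lemma C_kernel (e : 'rV[L]_3) : (forall l, e *m C l = 0) -> e = 0.
Proof.
move=> h; apply/rowP => n; rewrite mxE; apply: C_inj => //=.
apply/matrixP => a b; have /rowP/(_ a) := h b; rewrite !mxE => <-.
rewrite summxE; apply: eq_bigr => i _; rewrite !mxE; congr (_ * _).
by rewrite C_cyc C_cyc.
Qed.

Lemma twist_eq0 v : twist v = 0.
Proof.
have h l : exists y, twist v *m C l = y%:M.
  apply: (trace_web_scalar (z := (X' *m X) l v - q ^+ 2 * (l == v)%:R)) => m j.
  by rewrite mulmxA trace_twist.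
have hz l : twist v *m C l = 0.
  have [y0 e0] := h l.
  (* A nonzero scalar would make [twist v] invertible, and then C_l and C_(l+1) would be linearly
     dependent. *)
  have [y00|y00] := eqVneq y0 0; first by rewrite e0 y00 raddf0.
  exfalso; have U : twist v \in unitmx.
    have /mulmx1_unit[] // : twist v *m (y0^-1 *: C l) = 1%:M.
    by rewrite -scalemxAr e0 scale_scalar_mx mulVf.
  pose l' := l + 1.
  have l'l : (l' == l) = false by case: (l) @l' => [[|[|[|?]]] ?].
  have [y1 e1] := h l'.
  have e : y0 *: C l' - y1 *: C l = 0.
    rewrite -[LHS]mul1mx -(mulVmx U) -mulmxA mulmxBr -!scalemxAr e0 e1.
    by rewrite !scale_scalar_mx mulrC subrr mulmx0.
  move/eqP: y00; apply.
  have := C_inj (x := fun i => y0 * (i == l')%:R - y1 * (i == l)%:R).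
  have -> : \sum_i (y0 * (i == l')%:R - y1 * (i == l)%:R) *: C i = y0 *: C l' - y1 *: C l.
    under eq_bigr do rewrite scalerBl; rewrite sumrB; congr (_ - _).
      rewrite (bigD1 l') //= eqxx mulr1 big1 ?addr0 // => i /negbTE ->.
      by rewrite mulr0 scale0r.
    rewrite (bigD1 l) //= eqxx mulr1 big1 ?addr0 // => i /negbTE ->.
    by rewrite mulr0 scale0r.
  by move=> /(_ e l'); rewrite eqxx l'l mulr1 mulr0 subr0.
apply/row_matrixP => n; rewrite row0; apply: C_kernel => l.
by rewrite -row_mul hz row0.
Qed.

Lemma web_rotation v : \sum_a X a v *: Phi' a = q *: Phi v.
Proof. by apply/eqP; rewrite -subr_eq0; apply/eqP; apply: twist_eq0. Qed.

(** Once the twist is zero, the scalar left over in [trace_twist] has to vanish. *)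
Lemma mul_X'X : X' *m X = (q ^+ 2)%:M.
Proof.
apply/matrixP => l v; rewrite [RHS]mxE.
have := trace_twist 0 l 0 v; rewrite twist_eq0 mulmx0 !mul0mx raddf0 eqxx mul1r.
by move/esym/eqP; rewrite subr_eq0 mulr_natr => /eqP.
Qed.

Lemma mul_XX' : X *m X' = (q ^+ 2)%:M.
Proof.
have e : (q ^- 2 *: X') *m X = 1%:M.
  by rewrite -scalemxAl mul_X'X scale_scalar_mx mulVf // expf_neq0.
have := mulmx1C e; rewrite -scalemxAr => e'.
by rewrite -[LHS](scale1r) -(divff (expf_neq0 2 q0)) -scalerA e' scale_scalar_mx mulr1.
Qed.

Lemma rot_X x y z : \sum_a X a x * G z a y = q * G y z x.
Proof.
have := congr1 (fun M : 'M_3 => M z y) (web_rotation x); rewrite /= summxE !mxE => <-.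
by apply: eq_bigr => a _; rewrite !mxE.
Qed.

Lemma rot_X' x y z : \sum_a X' a x * G y z a = q * G z x y.
Proof.
apply: (mulfI q0); rewrite mulr_sumr mulrA -expr2.
transitivity (\sum_a X' a x * (q * G y z a)).
  by apply: eq_bigr => a _; ring.
under eq_bigr do rewrite -rot_X.
under eq_bigr do rewrite mulr_sumr; rewrite exchange_big /=.
transitivity (\sum_a (X *m X') a x * G z a y).
  by apply: eq_bigr => a _; rewrite mxE mulr_suml; apply: eq_bigr => i _; ring.
rewrite mul_XX' -(sum_delta (fun a => q ^+ 2 * G z a y)).
by apply: eq_bigr => a _; rewrite !mxE -mulr_natr; ring.
Qed.

(** Put l = v in [square] and sum: one side becomes a bigon inside a bigon, (1 + q)^2, the other is
    q + tr X. *)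
Lemma trace_X : \tr X = 1 + q + q ^+ 2.
Proof.
have bg m j : \sum_l (C l *m Phi l) m j = (1 + q) * (m == j)%:R.
  rewrite -bigon traceE; under [LHS]eq_bigr do rewrite mxE.
  rewrite exchange_big /=.
  by apply: eq_bigr => l _; apply: eq_bigr => n _; rewrite !mxE C_cyc.
have : \sum_l \tr (C l *m Phi l *m C 0 *m (G 0)^T) = (1 + q) * (1 + q).
  transitivity (\tr ((\sum_l C l *m Phi l) *m C 0 *m (G 0)^T)).
    by rewrite !mulmx_suml raddf_sum.
  have -> : \sum_l C l *m Phi l = (1 + q)%:M.
    by apply/matrixP => m j; rewrite summxE bg !mxE mulr_natr.
  by rewrite mul_scalar_mx -scalemxAl mxtraceZ bigon eqxx mulr1.
under eq_bigr do rewrite square eqxx mul1r.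
rewrite big_split /= -mulr_sumr.
rewrite sum_delta eqxx mulr1 => e.
transitivity (q + \sum_i X i i - q); first by rewrite addrC addKr.
by rewrite e; ring.
Qed.

Lemma trace_X' : \tr X' = 1 + q + q ^+ 2.
Proof.
have bg : \sum_l Phi' l *m C l = (1 + q)%:M.
  apply/matrixP => j n; rewrite summxE !mxE -mulr_natr eq_sym -bigon traceE.
  apply: eq_bigr => l _; rewrite mxE; apply: eq_bigr => p _.
  by rewrite mxE mulrC C_cyc C_cyc.
have : \sum_l \tr (C l *m (G 0)^T *m C 0 *m Phi' l) = (1 + q) * (1 + q).
  transitivity (\tr ((\sum_l Phi' l *m C l) *m ((G 0)^T *m C 0))).
    rewrite !mulmx_suml raddf_sum; apply: eq_bigr => l _ /=.
    by rewrite mxtrace_mulC !mulmxA.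
  by rewrite bg mul_scalar_mx mxtraceZ mxtrace_mulC bigon eqxx mulr1.
under eq_bigr do rewrite square' eqxx mul1r.
rewrite big_split /= -mulr_sumr sum_delta eqxx mulr1 => e.
transitivity (q + \sum_i X' i i - q); first by rewrite addrC addKr.
by rewrite e; ring.
Qed.

Definition nu := q^-1 *: X.
Definition nuV := q^-1 *: X'.

Lemma nuVK : nuV *m nu = 1%:M.
Proof.
rewrite -scalemxAl -scalemxAr scalerA mul_X'X scale_scalar_mx -expr2 exprVn.
by rewrite mulVf // expf_neq0.
Qed.

Lemma nuKV : nu *m nuV = 1%:M. Proof. exact: mulmx1C nuVK. Qed.

Lemma rot_nu x y z : \sum_a nu a x * G z a y = G y z x.
Proof.
apply: (mulfI q0); rewrite -rot_X mulr_sumr; apply: eq_bigr => a _.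
by rewrite mxE !mulrA divff // mul1r.
Qed.

Lemma PhiE v : Phi v = nuV^T *m (G v)^T.
Proof.
apply/matrixP => n j; rewrite !mxE; apply: (mulfI q0).
rewrite -rot_X' mulr_sumr; apply: eq_bigr => a _.
by rewrite !mxE !mulrA divff // mul1r.
Qed.

Lemma square_nu l v r u :
  \tr (C l *m nuV^T *m (G v)^T *m C r *m (G u)^T)
  = q * ((r == v)%:R * (l == u)%:R + nu l v * (r == u)%:R).
Proof.
rewrite -(mulmxA (C l)) -PhiE square mulrDr; congr (_ + _).
by rewrite mxE !mulrA divff // mul1r mulrC.
Qed.

Lemma trace_nu : q * \tr nu = 1 + q + q ^+ 2.
Proof. by rewrite mxtraceZ mulrA divff // mul1r trace_X. Qed.

Lemma trace_nuV : q * \tr nuV = 1 + q + q ^+ 2.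
Proof. by rewrite mxtraceZ mulrA divff // mul1r trace_X'. Qed.

(** The counterpart of [square_complete] for [square']: contracted with C_n Phi_k, the traces
    reassemble into q N plus a scalar. *)
Lemma square'_complete (N : 'M[L]_3) :
  (forall r u, \tr (C r *m (G u)^T *m N) = 0) -> exists y, N = y%:M.
Proof.
move=> h; exists (- q^-1 * \sum_l \sum_z X' l z * N z l).
apply/matrixP => m j; rewrite [RHS]mxE; apply: (mulfI q0).
transitivity (- ((\sum_l \sum_z X' l z * N z l) * (m == j)%:R)); last first.
  by rewrite -[in RHS]mulr_natr !mulrA mulrN divff // mulN1r mulNr.
apply/eqP; rewrite -subr_eq0 opprK; apply/eqP.
have key l z : \sum_n \sum_k (C k *m (G n)^T) l z * (C n *m Phi k) m j
    = \tr (C l *m (G j)^T *m C m *m Phi' z).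
  rewrite -(mulmxA (C l *m _)) mxtrace_mulE.
  transitivity (\sum_n \sum_k \sum_i \sum_p C k l i * G n z i * (C n m p * G j p k)).
    apply: eq_bigr => n _; apply: eq_bigr => k _; rewrite mxE mulr_suml.
    apply: eq_bigr => i _; rewrite [(C n *m _) m j]mxE mulr_sumr; apply: eq_bigr => p _.
    by rewrite !mxE.
  under eq_bigr do rewrite exchange_big; rewrite exchange_big; apply: eq_bigr => i _.
  under eq_bigr do rewrite exchange_big; rewrite exchange_big; apply: eq_bigr => p _.
  rewrite mxE mulr_suml exchange_big; apply: eq_bigr => k _.
  rewrite [(C m *m _) p i]mxE mulr_sumr; apply: eq_bigr => n _.
  by rewrite !mxE (C_cyc k) (C_cyc n); ring.
transitivity (\sum_n \sum_k \tr (C k *m (G n)^T *m N) * (C n *m Phi k) m j); last first.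
  by rewrite big1 // => n _; rewrite big1 // => k _; rewrite h mul0r.
transitivity (\sum_l \sum_z N z l * \tr (C l *m (G j)^T *m C m *m Phi' z)).
  under [RHS]eq_bigr do under eq_bigr do rewrite square' mulrDr.
  under [RHS]eq_bigr do rewrite big_split; rewrite big_split; congr (_ + _) => /=.
    rewrite -(sum_delta (fun l => q * N m l)); apply: eq_bigr => l _.
    rewrite -[q * N m l](sum_delta' (fun z => q * N z l)) mulr_suml.
    by apply: eq_bigr => z _; ring.
  rewrite mulr_suml; apply: eq_bigr => l _; rewrite mulr_suml; apply: eq_bigr => z _.
  by ring.
transitivity (\sum_l \sum_z \sum_n \sum_k N z l * ((C k *m (G n)^T) l z * (C n *m Phi k) m j)).
  apply: eq_bigr => l _; apply: eq_bigr => z _; rewrite -key mulr_sumr.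
  by apply: eq_bigr => n _; rewrite mulr_sumr.
under eq_bigr do rewrite exchange_big; rewrite exchange_big; apply: eq_bigr => n _.
under eq_bigr do rewrite exchange_big; rewrite exchange_big; apply: eq_bigr => k _.
rewrite mxtrace_mulE mulr_suml; apply: eq_bigr => l _; rewrite mulr_suml.
by apply: eq_bigr => z _; ring.
Qed.

(** In [square_nu] with v different from r only the term nu(l, v) w_r survives, and column v of the
    invertible matrix nu is not zero. *)
Lemma G_inj (w : 'I_3 -> L) : \sum_u w u *: G u = 0 -> forall r, w r = 0.
Proof.
move=> h r; pose v := r + 1.
have rv : (r == v) = false by case: (r) @v => [[|[|[|?]]] ?].
have z l : nu l v * w r = 0.
  apply: (mulfI q0); rewrite mulr0.
  transitivity (\tr (C l *m nuV^T *m (G v)^T *m C r *m (\sum_u w u *: G u)^T)); last first.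
    by rewrite h trmx0 mulmx0 raddf0.
  rewrite raddf_sum mulmx_sumr raddf_sum /= -(sum_delta' w) !mulr_sumr.
  apply: eq_bigr => u _.
  have -> : (w u *: G u)^T = w u *: (G u)^T by apply/matrixP => x y; rewrite !mxE.
  by rewrite -scalemxAr mxtraceZ square_nu rv /=; ring.
have := congr1 (fun M : 'M_3 => M v v) nuVK; rewrite /= !mxE eqxx => e.
rewrite -[w r]mul1r -[1]e mulr_suml big1 // => l _.
by rewrite -mulrA z mulr0.
Qed.

(** Three rotations return to the starting entry with one factor nu on each leg. *)
Lemma nu_invG u : nu^T *m (\sum_b nu b u *: G b) *m nu = G u.
Proof.
apply/matrixP => x y; rewrite -rot_nu mxE; apply: eq_bigr => c _.
rewrite mulrC -(rot_nu u); congr (_ * _).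
transitivity (\sum_a \sum_b nu b u * (nu a x * G b a c)).
  rewrite mxE; apply: eq_bigr => a _; rewrite summxE mulr_sumr.
  by apply: eq_bigr => b _; rewrite !mxE; ring.
rewrite exchange_big; apply: eq_bigr => b _.
by rewrite -mulr_sumr rot_nu.
Qed.

(** The word C G C G under the trace can be evaluated by [square_nu] from either of its two C.
    Comparing both readings shows that K_l = nu C_l - (nu^-1 C)_l nu^-T is invisible to all traces,
    so each K_l G_v^T is scalar, and independence of the G_v makes it 0. *)
Lemma nu_invC l : nu *m (\sum_a nu l a *: C a) *m nu^T = C l.
Proof.
pose GG u := \sum_b nu b u *: G b.
pose CC l := \sum_a nuV l a *: C a.
pose K l := nu *m C l - CC l *m nuV^T.
have GGE u : nuV^T *m (G u)^T = (GG u)^T *m nu.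
  rewrite -trmx_mul; have -> : G u *m nuV = nu^T *m GG u.
    by rewrite -{1}(nu_invG u) -/(GG u) -(mulmxA _ nu) nuKV mulmx1.
  by rewrite trmx_mul trmxK.
have VE (l1 u : 'I_3) : \sum_a nuV l1 a * nu a u = (l1 == u)%:R.
  by have := congr1 (fun M : 'M_3 => M l1 u) nuVK; rewrite /= !mxE.
have K0 r u l' v : \tr (C r *m (GG u)^T *m (K l' *m (G v)^T)) = 0.
  rewrite mulmxBl mulmxBr raddfB /=; apply/eqP; rewrite subr_eq0; apply/eqP.
  transitivity (q * ((r == v)%:R * (l' == u)%:R + nu r u * (l' == v)%:R)).
    by rewrite !mulmxA -(mulmxA (C r)) -GGE mulmxA square_nu; ring.
  transitivity (\sum_a nuV l' a * \sum_b nu b u *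
      (q * ((r == v)%:R * (a == b)%:R + nu a v * (r == b)%:R))).
    rewrite -(VE l' u) -(VE l' v) !mulr_sumr -big_split mulr_sumr; apply: eq_bigr => a _ /=.
    transitivity (nuV l' a * (q * (r == v)%:R * nu a u + q * nu a v * nu r u)); first by ring.
    congr (_ * _); rewrite -(sum_delta' (nu ^~ u) a) -(sum_delta' (nu ^~ u) r).
    by rewrite !mulr_sumr -big_split; apply: eq_bigr => b _ /=; ring.
  rewrite mxtrace_mulC !mulmxA /CC !mulmx_suml raddf_sum; apply: eq_bigr => a _ /=.
  rewrite -!scalemxAl mxtraceZ; congr (_ * _).
  have -> : (GG u)^T = \sum_b nu b u *: (G b)^T.
    by apply/matrixP => x y; rewrite mxE !summxE; apply: eq_bigr => b _; rewrite !mxE.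
  rewrite mulmx_sumr raddf_sum; apply: eq_bigr => b _ /=.
  by rewrite -scalemxAr mxtraceZ square_nu.
have KE l' : K l' = nu *m C l' - CC l' *m nuV^T by [].
clearbody K.
have KG l' v : exists y, K l' *m (G v)^T = y%:M.
  apply: square'_complete => r u.
  pose w : 'rV[L]_3 := \row_b \tr (C r *m (G b)^T *m (K l' *m (G v)^T)).
  have w0 : w *m nu = 0.
    apply/rowP => u'; rewrite mxE [RHS]mxE -[RHS](K0 r u' l' v).
    have -> : (GG u')^T = \sum_b nu b u' *: (G b)^T.
      by apply/matrixP => x y; rewrite mxE !summxE; apply: eq_bigr => b _; rewrite !mxE.
    rewrite mulmx_sumr mulmx_suml raddf_sum; apply: eq_bigr => b _ /=.
    by rewrite -scalemxAr -scalemxAl mxtraceZ mxE mulrC.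
  have : w = 0 by rewrite -[w]mulmx1 -nuKV mulmxA w0 mul0mx.
  by move/rowP/(_ u); rewrite !mxE.
have Kz l' : K l' = 0.
  have KG0 v : K l' *m (G v)^T = 0.
    have [y0 e0] := KG l' v; have [y1 e1] := KG l' (v + 1).
    have [y00|y00] := eqVneq y0 0; first by rewrite e0 y00 raddf0.
    exfalso; have U : K l' \in unitmx.
      have /mulmx1_unit[] // : K l' *m (y0^-1 *: (G v)^T) = 1%:M.
      by rewrite -scalemxAr e0 scale_scalar_mx mulVf.
    have e : y0 *: G (v + 1) - y1 *: G v = 0.
      apply: trmx_inj; rewrite trmx0.
      transitivity (y0 *: (G (v + 1))^T - y1 *: (G v)^T).
        by apply/matrixP => x y; rewrite !mxE.
      rewrite -[LHS]mul1mx -(mulVmx U) -mulmxA mulmxBr -!scalemxAr e0 e1.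
      by rewrite !scale_scalar_mx mulrC subrr mulmx0.
    have v1v : (v + 1 == v) = false by case: (v) => [[|[|[|?]]] ?].
    have := G_inj (w := fun i => y0 * (i == v + 1)%:R - y1 * (i == v)%:R).
    have -> : \sum_i (y0 * (i == v + 1)%:R - y1 * (i == v)%:R) *: G i = y0 *: G (v + 1) - y1 *: G v.
      under eq_bigr do rewrite scalerBl; rewrite sumrB; congr (_ - _).
        rewrite (bigD1 (v + 1)) //= eqxx mulr1 big1 ?addr0 // => i /negbTE ->.
        by rewrite mulr0 scale0r.
      rewrite (bigD1 v) //= eqxx mulr1 big1 ?addr0 // => i /negbTE ->.
      by rewrite mulr0 scale0r.
    move=> /(_ e (v + 1)); rewrite eqxx v1v mulr1 mulr0 subr0 => y0z.
    by rewrite y0z eqxx in y00.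
  (* Rotation turns K G_y^T = 0 for all y into sum_k K(i, k) G_k = 0, where [G_inj] applies. *)
  apply/matrixP => i k; rewrite [RHS]mxE; move: k.
  apply: (G_inj (w := fun k => K l' i k)); apply/matrixP => y x.
  rewrite summxE mxE; transitivity (\sum_a nu a x * (K l' *m (G y)^T) i a).
    transitivity (\sum_a \sum_k nu a x * (K l' i k * G y a k)).
      rewrite exchange_big; apply: eq_bigr => k _; rewrite mxE -rot_nu mulr_sumr.
      by apply: eq_bigr => a _; ring.
    apply: eq_bigr => a _; rewrite [(K l' *m _) i a]mxE mulr_sumr.
    by apply: eq_bigr => k _; rewrite [(G y)^T k a]mxE.
  by rewrite big1 // => a _; rewrite KG0 [_ i a]mxE mulr0.
have CCE l' : CC l' = nu *m C l' *m nu^T.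
  move/eqP: (Kz l'); rewrite KE subr_eq0 => /eqP ->.
  by rewrite -mulmxA -trmx_mul nuKV trmx1 mulmx1.
rewrite -[RHS]/(_) mulmx_sumr mulmx_suml.
transitivity (\sum_a nu l a *: CC a).
  by apply: eq_bigr => a _; rewrite CCE -scalemxAr -scalemxAl.
transitivity (\sum_b (nu *m nuV) l b *: C b).
  under eq_bigr do rewrite scaler_sumr; rewrite exchange_big; apply: eq_bigr => b _.
  rewrite mxE scaler_suml; apply: eq_bigr => a _; by rewrite scalerA.
rewrite nuKV (bigD1 l) //= !mxE eqxx scale1r big1 ?addr0 // => b.
by rewrite mxE eq_sym => /negbTE ->; rewrite scale0r.
Qed.

End Web.

(** * Diagonalizability of the twist *)

Lemma non_uniq_perm (T : eqType) (s : seq T) :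
  ~~ uniq s -> exists x t, perm_eq s (x :: x :: t).
Proof.
elim: s => //= y s IH; rewrite negb_and negbK => /orP [ys|/IH [x [t st]]].
  by exists y, (rem y s); rewrite perm_cons perm_to_rem.
exists x, (y :: t); rewrite -[_ :: _]/([:: y] ++ s) -[X in perm_eq _ X]/([:: x; x] ++ [:: y] ++ t).
by rewrite perm_sym perm_catCA perm_cat2l perm_sym.
Qed.

(** If the minimal polynomial had a double root x, the hypothesis would allow one factor X - x to be
    dropped, against minimality. *)
Lemma diagonalizable_no_jordan (L : closedFieldType) n (A : 'M[L]_n.+1) :
  (forall x (v : 'rV_n.+1), v *m (A - x%:M) *m (A - x%:M) = 0 -> v *m (A - x%:M) = 0) ->
  exists P (d : 'rV_n.+1), P \in unitmx /\ P *m A = diag_mx d *m P.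
Proof.
move=> h.
have [P Pu /(mxpoly.diagonalizable_forP _ Pu) hP] : mxpoly.diagonalizable A.
  apply/mxpoly.diagonalizableP.
  have [rs] := closed_field_poly_normal (mxminpoly A).
  rewrite (monicP (mxminpoly_monic A)) scale1r => e.
  exists rs; last by rewrite -e.
  apply/negPn/negP => /non_uniq_perm [x [t st]].
  rewrite (perm_big _ st) /= !big_cons mulrA mulrAC in e.
  set g := \prod_(_ <- _) _ in e; set p := 'X - x%:P in e.
  have pA : horner_mx A p = A - x%:M by rewrite rmorphB /= horner_mx_X horner_mx_C.
  have z : horner_mx A (g * p) = 0.
    apply/row_matrixP => i; rewrite row0 rmorphM /= -mulmxE row_mul pA; apply: h.
    rewrite -!row_mul -pA !mulmxE -!rmorphM /=.
    have -> : g * p * p = mxminpoly A by rewrite e; ring.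
    by rewrite mx_root_minpoly row0.
  have := mxminpoly_min z; rewrite e.
  have gp0 : g * p != 0.
    apply: contraNneq (monic_neq0 (mxminpoly_monic A)) => gp.
    by rewrite e -mulrA gp mulr0.
  have -> : p * g * p = p * (g * p) by ring.
  rewrite -[X in _ %| X]mul1r dvdp_mul2r // dvdp1 size_XsubC //.
pose D := \row_i (P *m A *m invmx P) i i; exists P, D; split=> //.
have -> : diag_mx D = P *m A *m invmx P.
  apply/matrixP => i j; rewrite mxE [D 0 i]mxE.
  have [->|ij] := eqVneq i j; first by rewrite mulr1n.
  by rewrite mulr0n hP.
by rewrite mulmxKV.
Qed.

(* Basis-free form of [hecke_tensors]: [C] and [G] are the slices of the
   potential and of its dual, [nu] is the twist and [nuV] its inverse, acting on
   row vectors. *)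
Record web (L : fieldType) (q : L) (nu nuV : 'M[L]_3) (C G : 'I_3 -> 'M[L]_3) : Prop := Web {
  w_cyc : forall i m n, C i m n = C m n i;
  w_rot : forall x y z, \sum_a nu a x * G z a y = G y z x;
  w_inv : forall l, nu *m (\sum_a nu l a *: C a) *m nu^T = C l;
  w_nuV : nuV *m nu = 1%:M;
  w_bigon : forall i u, \tr (C i *m (G u)^T) = (1 + q) * (i == u)%:R;
  w_square : forall l v r u,
    \tr (C l *m nuV^T *m (G v)^T *m C r *m (G u)^T)
    = q * ((r == v)%:R * (l == u)%:R + nu l v * (r == u)%:R);
  w_tr : q * \tr nu = 1 + q + q ^+ 2;
  w_trV : q * \tr nuV = 1 + q + q ^+ 2;
  w_smooth : forall x : 'I_3 -> L,
    (forall k, \sum_i \sum_j x i * x j * C i j k = 0) -> forall i, x i = 0 }.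

Section WebTheory.
Variables (L : fieldType) (q : L) (nu nuV : 'M[L]_3) (C G : 'I_3 -> 'M[L]_3).
Hypothesis W : web q nu nuV C G.

Definition c3 (x y z : 'rV[L]_3) : L :=
  \sum_a \sum_b \sum_e x 0 a * y 0 b * z 0 e * C a b e.

Lemma c3_cyc x y z : c3 x y z = c3 y z x.
Proof.
rewrite /c3 exchange_big; apply: eq_bigr => b _; rewrite exchange_big.
apply: eq_bigr => e _; apply: eq_bigr => a _; rewrite (w_cyc W); ring.
Qed.

Lemma c3_linl k x x' y z : c3 (k *: x + x') y z = k * c3 x y z + c3 x' y z.
Proof.
rewrite /c3 mulr_sumr -big_split; apply: eq_bigr => a _.
rewrite mulr_sumr -big_split; apply: eq_bigr => b _.
rewrite mulr_sumr -big_split; apply: eq_bigr => e _.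
by rewrite !mxE /=; ring.
Qed.

Lemma c3_mx x y z : c3 x y z = (y *m (\sum_a x 0 a *: C a) *m z^T) 0 0.
Proof.
rewrite /c3 mxE.
transitivity (\sum_e \sum_b \sum_a x 0 a * y 0 b * z 0 e * C a b e).
  rewrite exchange_big; under eq_bigr do rewrite exchange_big.
  by rewrite exchange_big.
apply: eq_bigr => e _; rewrite [z^T e 0]mxE mxE mulr_suml; apply: eq_bigr => b _.
rewrite summxE mulr_sumr mulr_suml; apply: eq_bigr => a _.
by rewrite mxE; ring.
Qed.

Lemma c3_inv x y z : c3 (x *m nu) (y *m nu) (z *m nu) = c3 x y z.
Proof.
rewrite !c3_mx; set M := \sum_a _.
transitivity ((y *m (nu *m M *m nu^T) *m z^T) 0 0); first by rewrite trmx_mul !mulmxA.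
congr ((y *m _ *m _) 0 0).
transitivity (\sum_l x 0 l *: (nu *m (\sum_a nu l a *: C a) *m nu^T)); last first.
  by apply: eq_bigr => l _; rewrite (w_inv W).
transitivity (nu *m (\sum_l x 0 l *: \sum_a nu l a *: C a) *m nu^T); last first.
  rewrite mulmx_sumr mulmx_suml; apply: eq_bigr => l _.
  by rewrite -scalemxAr -scalemxAl.
congr (_ *m _ *m _); under [RHS]eq_bigr do rewrite scaler_sumr.
rewrite exchange_big; apply: eq_bigr => a _; rewrite mxE scaler_suml.
by apply: eq_bigr => l _; rewrite scalerA.
Qed.

Lemma c3_0 y z : c3 0 y z = 0.
Proof. by have := c3_linl (-1) 0 0 y z; rewrite scaleN1r addNr mulN1r addNr. Qed.

Lemma c3D x x' y z : c3 (x + x') y z = c3 x y z + c3 x' y z.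
Proof. by rewrite -{1}[x]scale1r c3_linl mul1r. Qed.

Lemma c3Z k x y z : c3 (k *: x) y z = k * c3 x y z.
Proof. by rewrite -[k *: x]addr0 c3_linl c3_0 addr0. Qed.

Lemma c3_smooth p : (forall z, c3 p p z = 0) -> p = 0.
Proof.
move=> h; apply/rowP => i; rewrite mxE; apply: (w_smooth W) => // k.
rewrite -[RHS](h (delta_mx 0 k)) /c3; apply: eq_bigr => a _; apply: eq_bigr => b _.
rewrite (bigD1 k) //= mxE !eqxx mulr1 big1 ?addr0 // => e /negbTE ek.
by rewrite mxE ek andbF mulr0 mul0r.
Qed.

Hypotheses (two0 : (2%:R : L) != 0) (three0 : (3%:R : L) != 0).

(** Otherwise v and the eigenvector p form a Jordan chain. The linear forms g = c(p, p, _) and B =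
    c(p, v, _) inherit transformation laws under nu. Since g kills p and v but is not 0, some z0
    completes a basis, and the two laws at z0 are incompatible. *)
Lemma web_no_jordan lam (v : 'rV[L]_3) :
  v *m (nu - lam%:M) *m (nu - lam%:M) = 0 -> v *m (nu - lam%:M) = 0.
Proof.
set p := v *m _ => hp; apply/eqP/negPn/negP => p0.
have pE : p *m nu = lam *: p.
  by apply/eqP; rewrite -subr_eq0 -mul_mx_scalar -mulmxBr hp.
have vE : v *m nu = lam *: v + p.
  by rewrite /p mulmxBr mul_mx_scalar addrC subrK.
have lam0 : lam != 0.
  apply: contra_neq p0 => l0; rewrite -[p]mulmx1 -(mulmx1C (w_nuV W)) mulmxA pE l0.
  by rewrite scale0r mul0mx.
have r2 a b x y z : c3 x (a *: b + y) z = a * c3 x b z + c3 x y z.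
  by rewrite (c3_cyc x) c3_linl (c3_cyc x b) (c3_cyc x y).
have r3 a b x y z : c3 x y (a *: b + z) = a * c3 x y b + c3 x y z.
  by rewrite -(c3_cyc (a *: b + z)) c3_linl (c3_cyc b) (c3_cyc z).
have s2 a b x z : c3 x (a *: b) z = a * c3 x b z by rewrite (c3_cyc x) c3Z (c3_cyc x b).
have s3 a x y z : c3 x y (a *: z) = a * c3 x y z by rewrite -(c3_cyc (a *: z)) c3Z (c3_cyc z).
pose g := c3 p p; pose B := c3 p v.
have g_nu z : lam ^+ 2 * g (z *m nu) = g z.
  by rewrite /g -[RHS]c3_inv pE c3Z s2; ring.
have B_nu z : lam ^+ 2 * B (z *m nu) + lam * g (z *m nu) = B z.
  by rewrite /B /g -[RHS]c3_inv pE vE c3Z r2; ring.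
have h0 := g_nu p; have h1 := g_nu v; have h2 := B_nu v.
rewrite pE vE /g /B ?s3 ?r3 in h0 h1 h2.
have h3 := c3_inv v v v; rewrite vE ?c3_linl ?r2 ?r3 in h3.
have e1 : c3 p v p = c3 p p v by rewrite [RHS]c3_cyc.
have e2 : c3 v v p = c3 p v v by rewrite [RHS]c3_cyc.
have e3 : c3 v p v = c3 p v v by rewrite c3_cyc.
have e4 : c3 v p p = c3 p p v by rewrite c3_cyc.
rewrite e1 ?e2 ?e3 ?e4 in h2 h3.
have [g0 g1 b0] : [/\ g p = 0, g v = 0 & B v = 0].
  rewrite /g /B; move: (c3 p p p) (c3 p p v) (c3 p v v) (c3 v v v) h0 h1 h2 h3 => a b x t.
  (* If lam^3 = 1 the leading terms cancel and the equations give a, 2 b and 3 x equal to 0 in turn;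
     this is where the characteristic enters. *)
  move=> h0 h1 h2 h3; have [l3|l3] := eqVneq (lam ^+ 3) 1.
    have a0 : a = 0.
      apply: (mulfI (expf_neq0 2 lam0)); rewrite mulr0.
      by apply: (eq_lin 1 h1); apply: (eq_lin (- b) l3); ring.
    have b0 : b = 0.
      apply: (mulfI two0); apply: (mulfI (expf_neq0 2 lam0)); rewrite !mulr0.
      by apply: (eq_lin 1 h2); apply: (eq_lin (- x) l3); rewrite a0; ring.
    split=> //; apply: (mulfI three0); apply: (mulfI (expf_neq0 2 lam0)); rewrite !mulr0.
    by apply: (eq_lin 1 h3); apply: (eq_lin (- t) l3); rewrite a0 b0; ring.
  have l30 : lam ^+ 3 - 1 != 0 by rewrite subr_eq0.
  have a0 : a = 0.
    by apply: (mulfI l30); rewrite mulr0; apply: (eq_lin 1 h0); ring.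
  have b0 : b = 0.
    by apply: (mulfI l30); rewrite mulr0; apply: (eq_lin 1 h1); rewrite a0; ring.
  split=> //; apply: (mulfI l30); rewrite mulr0; apply: (eq_lin 1 h2).
  by rewrite a0 b0; ring.
have gz : exists z, g z != 0.
  have [/forallP h|] := boolP [forall k, g (delta_mx 0 k) == 0]; last first.
    by rewrite negb_forall => /existsP [k]; exists (delta_mx 0 k).
  move/eqP: p0; case; apply: c3_smooth => z; rewrite -/g /g -c3_cyc.
  rewrite [z]row_sum_delta; apply: (big_ind (fun x => c3 x p p = 0)).
  - exact: c3_0.
  - by move=> x y hx hy; rewrite c3D hx hy addr0.
  by move=> k _; rewrite c3Z c3_cyc; have /eqP := h k; rewrite /g => ->; rewrite mulr0.
have [z0 gz0] := gz.
pose M : 'M[L]_3 := \matrix_i (if i == 0 then p else if i == 1 then v else z0).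
have ME (w : 'rV_3) : w *m M = w 0 0 *: p + w 0 1 *: v + w 0 (1 + 1) *: z0.
  rewrite mulmx_sum_row (@sum3 _ 0 1 (1 + 1)) //.
  by rewrite !rowK /=.
have MU : M \in unitmx.
  rewrite -row_free_unit -kermx_eq0; apply/rowV0P => w /sub_kermxP; rewrite ME => wM.
  have w2 : w 0 (1 + 1) = 0.
    have : g (w 0 0 *: p + w 0 1 *: v + w 0 (1 + 1) *: z0) = 0.
      by rewrite wM /g -c3_cyc c3_0.
    rewrite /g -c3_cyc !c3D !c3Z !(c3_cyc _ p p) -/(g p) -/(g v) g0 g1 !mulr0 !add0r.
    by move/eqP; rewrite mulf_eq0 (negbTE gz0) orbF => /eqP.
  have w1 : w 0 1 = 0.
    have : (w 0 0 *: p + w 0 1 *: v + w 0 (1 + 1) *: z0) *m (nu - lam%:M) = 0.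
      by rewrite wM mul0mx.
    rewrite w2 scale0r addr0 mulmxDl -!scalemxAl hp scaler0 add0r => /eqP.
    by rewrite scaler_eq0 (negbTE p0) orbF => /eqP.
  have w0 : w 0 0 = 0.
    move/eqP: wM; rewrite w2 w1 !scale0r !addr0 scaler_eq0 (negbTE p0) orbF.
    by move/eqP.
  apply/rowP => i; rewrite mxE.
  by case: (@ord3_cover 0 1 (1 + 1) i) => // ->.
have := g_nu z0; have := B_nu z0.
rewrite -[z0 *m nu](mulmxKV MU) ME; set w := _ *m invmx M.
rewrite -addrA /g /B !r3 !s3 -/(g p) -/(g v) -/(g z0) e1 -/(g v) -/(B v) -/(B z0).
rewrite g0 g1 b0 !mulr0 !add0r => hB hg.
have m1 : lam ^+ 2 * w 0 (1 + 1) = 1.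
  by apply: (mulIf gz0); rewrite mul1r -mulrA.
have : lam * w 0 (1 + 1) * g z0 = 0.
  by apply: (eq_lin 1 hB); apply: (eq_lin (- B z0) m1); ring.
move/eqP; rewrite !mulf_eq0 (negbTE lam0) (negbTE gz0) orbF /= => /eqP w2.
by move/eqP: m1; rewrite w2 mulr0 eq_sym oner_eq0.
Qed.

End WebTheory.

(** * Base change to an eigenbasis *)

Lemma trace_mul4E (R : comPzRingType) n (A B C E : 'M[R]_n) :
  \tr (A *m B *m C *m E^T)
  = \sum_m \sum_n \sum_j \sum_k A m n * B n j * C j k * E m k.
Proof.
apply: eq_bigr => m _; rewrite mxE.
transitivity (\sum_k \sum_j \sum_i A m i * B i j * C j k * E m k).
  apply: eq_bigr => k _; rewrite [E^T k m]mxE mxE mulr_suml; apply: eq_bigr => j _.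
  by rewrite mxE !mulr_suml.
rewrite exchange_big; under eq_bigr do rewrite exchange_big.
by rewrite exchange_big.
Qed.

Section BaseChange.
Variables (L : fieldType) (q : L) (nu nuV : 'M[L]_3) (C G : 'I_3 -> 'M[L]_3).
Hypotheses (W : web q nu nuV C G) (q0 : q != 0).
Variables (P : 'M[L]_3) (d : 'rV[L]_3).
Hypotheses (PU : P \in unitmx) (Pnu : P *m nu = diag_mx d *m P).
Let Q := invmx P.
Let PQ : P *m Q = 1%:M. Proof. exact: mulmxV. Qed.
Let QP : Q *m P = 1%:M. Proof. exact: mulVmx. Qed.

Let CC i := \sum_a P i a *: C a.
Let GG u := \sum_b Q b u *: G b.
Let C' i := P *m CC i *m P^T.
Let G' u := Q^T *m GG u *m Q.

Definition eigen_c (i j k : 'I_3) : L := c3 C (row i P) (row j P) (row k P).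
(** The dual tensor transforms by the inverse matrix, and its third index is the slice label. *)
Definition eigen_f (x y z : 'I_3) : L := G' z x y.

Let C'E i j k : C' i j k = eigen_c i j k.
Proof.
rewrite /eigen_c c3_mx /C'.
have -> : \sum_a (row i P) 0 a *: C a = CC i by apply: eq_bigr => a _; rewrite mxE.
by rewrite -row_mul mxE [RHS]mxE; apply: eq_bigr => b _; rewrite !mxE.
Qed.

Let G'E u x y : G' u x y = \sum_a \sum_b \sum_e Q a x * Q b y * Q e u * G e a b.
Proof.
transitivity (\sum_b \sum_a \sum_e Q a x * Q b y * Q e u * G e a b).
  rewrite mxE; apply: eq_bigr => b _; rewrite mxE mulr_suml; apply: eq_bigr => a _.
  rewrite summxE [Q^T x a]mxE mulr_sumr mulr_suml; apply: eq_bigr => e _.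
  by rewrite mxE; ring.
by rewrite exchange_big.
Qed.

Let nuQ a x : \sum_b nu a b * Q b x = d 0 x * Q a x.
Proof.
have e : nu *m Q = Q *m diag_mx d.
  by rewrite -[nu]mul1mx -QP -(mulmxA Q) Pnu -!mulmxA PQ mulmx1.
have := congr1 (fun M : 'M_3 => M a x) e; rewrite /= mxE => ->.
by rewrite mul_mx_diag mxE mulrC.
Qed.

Lemma eigen_cycc i j k : eigen_c i j k = eigen_c j k i.
Proof. exact: (c3_cyc W). Qed.

Lemma eigen_rot x y z : d 0 x * eigen_f x y z = eigen_f z x y.
Proof.
rewrite /eigen_f !G'E.
transitivity (\sum_a \sum_b \sum_e \sum_c
    (Q e z * Q c x * Q b y * (nu a c * G e a b))).
  rewrite mulr_sumr; apply: eq_bigr => a _; rewrite mulr_sumr; apply: eq_bigr => b _.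
  rewrite mulr_sumr; apply: eq_bigr => e _.
  transitivity (\sum_b0 nu a b0 * Q b0 x * (Q b y * Q e z * G e a b)).
    by rewrite -mulr_suml nuQ; ring.
  by apply: eq_bigr => c _; ring.
rewrite exchange_big; under eq_bigr do rewrite exchange_big; rewrite exchange_big.
apply: eq_bigr => e _; under eq_bigr do rewrite exchange_big; rewrite exchange_big.
apply: eq_bigr => c _; apply: eq_bigr => b _.
by rewrite -mulr_sumr (w_rot W).
Qed.

Lemma eigen_inv i j k : d 0 i * d 0 j * d 0 k * eigen_c i j k = eigen_c i j k.
Proof.
rewrite -[RHS](c3_inv W) /eigen_c.
have e x : row x P *m nu = d 0 x *: row x P.
  by rewrite -row_mul Pnu mul_diag_mx; apply/rowP => a; rewrite !mxE.
rewrite !e.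
have z1 a x y z : c3 C (a *: x) y z = a * c3 C x y z by exact: c3Z.
have z2 a x y z : c3 C x (a *: y) z = a * c3 C x y z.
  by rewrite (c3_cyc W) z1 -(c3_cyc W).
have z3 a x y z : c3 C x y (a *: z) = a * c3 C x y z.
  by rewrite -(c3_cyc W) z1 (c3_cyc W).
by rewrite z1 z2 z3 !mulrA.
Qed.

Let d0 x : d 0 x != 0.
Proof.
apply/eqP => dx; have := congr1 (row x) Pnu.
rewrite mul_diag_mx row_mul => e.
have : row x P *m nu = 0 by rewrite e; apply/rowP => y; rewrite !mxE dx mul0r.
move/(congr1 (mulmx^~ nuV)); rewrite -mulmxA (mulmx1C (w_nuV W)) mulmx1 mul0mx => r0.
have := congr1 (row x) PQ; rewrite row_mul r0 mul0mx => /rowP /(_ x) /eqP.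
by rewrite !mxE eqxx eq_sym oner_eq0.
Qed.

Let trace_PQ (A B : 'M[L]_3) : \tr (P *m A *m P^T *m (Q^T *m B *m Q)^T) = \tr (A *m B^T).
Proof.
rewrite !trmx_mul trmxK !mulmxA -(mulmxA _ P^T) -trmx_mul QP trmx1 mulmx1.
by rewrite mxtrace_mulC !mulmxA QP mul1mx.
Qed.

Lemma eigen_bigon i u : \sum_m \sum_n eigen_c i m n * eigen_f m n u = (1 + q) * (i == u)%:R.
Proof.
transitivity (\tr (C' i *m (G' u)^T)).
  by rewrite mxtrace_mulE; apply: eq_bigr => m _; apply: eq_bigr => n _;
    rewrite C'E [_^T _ _]mxE.
rewrite trace_PQ.
transitivity (\sum_a \sum_b P i a * (Q b u * ((1 + q) * (a == b)%:R))).
  rewrite /CC mulmx_suml raddf_sum; apply: eq_bigr => a _ /=.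
  have -> : (GG u)^T = \sum_b Q b u *: (G b)^T.
    by apply/matrixP => x y; rewrite mxE !summxE; apply: eq_bigr => b _; rewrite !mxE.
  rewrite mulmx_sumr raddf_sum; apply: eq_bigr => b _ /=.
  by rewrite -scalemxAl -scalemxAr !mxtraceZ (w_bigon W).
have := congr1 (fun M : 'M_3 => M i u) PQ; rewrite /= !mxE => <-.
rewrite mulr_sumr; apply: eq_bigr => a _.
rewrite -mulr_sumr -(sum_delta' (Q ^~ u) a) !mulr_sumr.
by apply: eq_bigr => b _; ring.
Qed.

Lemma eigen_square l v r u :
  \sum_m \sum_n \sum_j \sum_k
    eigen_c l m n * eigen_f n v j * eigen_c r j k * eigen_f m k u
  = q * ((r == v)%:R * (l == u)%:R + d 0 v * (l == v)%:R * (r == u)%:R).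
Proof.
pose D : 'M[L]_3 := diag_mx (\row_x (d 0 x)^-1).
have DE n j w : (D *m (G' w)^T) n j = eigen_f n w j.
  rewrite mul_diag_mx mxE [(\row_x _) 0 n]mxE [_^T n j]mxE -[G' w j n]/(eigen_f j n w).
  apply: (mulfI (d0 n)).
  by rewrite mulrA divff // mul1r eigen_rot.
transitivity (\tr (C' l *m (D *m (G' v)^T) *m C' r *m (G' u)^T)).
  rewrite trace_mul4E; do 4!(apply: eq_bigr => ? _); by rewrite !C'E DE.
have nuVE : P^T *m D *m Q^T = nuV^T.
  have DT : D^T = D by rewrite tr_diag_mx.
  have -> : P^T *m D *m Q^T = (Q *m D *m P)^T by rewrite !trmx_mul DT mulmxA.
  congr (_^T); have e : nu *m (Q *m D *m P) = 1%:M.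
    have -> : nu = Q *m diag_mx d *m P by rewrite -mulmxA -Pnu mulmxA QP mul1mx.
    rewrite !mulmxA -(mulmxA _ P) PQ mulmx1 -(mulmxA Q).
    have -> : diag_mx d *m D = 1%:M.
      apply/matrixP => x y; rewrite mul_diag_mx !mxE.
      have [->|xy] := eqVneq x y; first by rewrite !mulr1n divff.
      by rewrite !mulr0n mulr0.
    by rewrite mulmx1 QP.
  by rewrite -[LHS]mul1mx -(w_nuV W) -(mulmxA nuV) e mulmx1.
transitivity (\tr (CC l *m nuV^T *m (GG v)^T *m CC r *m (GG u)^T)).
  rewrite -nuVE -(trace_PQ _ (GG u)) /C' /G' !trmx_mul !trmxK; congr (\tr _).
  rewrite !mulmxA; do 2!congr (_ *m _).
  have tPQ : P^T *m Q^T = 1%:M by rewrite -trmx_mul QP trmx1.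
  by rewrite -!mulmxA (mulmxA Q) QP mul1mx.
have PQE x y : \sum_a P x a * Q a y = (x == y)%:R.
  by have := congr1 (fun M : 'M_3 => M x y) PQ; rewrite /= !mxE.
have GGt w : (GG w)^T = \sum_b Q b w *: (G b)^T.
  by apply/matrixP => x y; rewrite mxE !summxE; apply: eq_bigr => b _; rewrite !mxE.
transitivity (\sum_a P l a * \sum_b Q b v * \sum_e P r e * \sum_g Q g u *
    (q * ((e == b)%:R * (a == g)%:R + nu a b * (e == g)%:R))).
  have CCE i : CC i = \sum_a P i a *: C a by [].
  move: (CC l) (CC r) (GG v)^T (GG u)^T (CCE l) (CCE r) (GGt v) (GGt u).
  move=> Cl Cr Gv Gu -> Er Ev Eu.
  rewrite !mulmx_suml raddf_sum; apply: eq_bigr => a _ /=.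
  rewrite -!scalemxAl mxtraceZ; congr (_ * _).
  rewrite Ev mulmx_sumr !mulmx_suml raddf_sum; apply: eq_bigr => b _ /=.
  rewrite -scalemxAr -!scalemxAl mxtraceZ; congr (_ * _).
  rewrite Er mulmx_sumr mulmx_suml raddf_sum.
  apply: eq_bigr => e _ /=; rewrite -scalemxAr -!scalemxAl mxtraceZ; congr (_ * _).
  rewrite Eu mulmx_sumr raddf_sum.
  by apply: eq_bigr => g _ /=; rewrite -scalemxAr mxtraceZ (w_square W).
transitivity (\sum_a P l a * \sum_b Q b v * \sum_e P r e *
    (q * ((e == b)%:R * Q a u + nu a b * Q e u))).
  apply: eq_bigr => a _; congr (_ * _); apply: eq_bigr => b _; congr (_ * _).
  apply: eq_bigr => e _; congr (_ * _).
  rewrite -(sum_delta' (Q ^~ u) a) -(sum_delta' (Q ^~ u) e) !mulr_sumr -big_split mulr_sumr.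
  by apply: eq_bigr => g _ /=; ring.
transitivity (\sum_a P l a * \sum_b Q b v * (q * (P r b * Q a u + nu a b * (r == u)%:R))).
  apply: eq_bigr => a _; congr (_ * _); apply: eq_bigr => b _; congr (_ * _).
  rewrite -(PQE r u) -(sum_delta (P r) b) mulr_suml mulr_sumr -big_split mulr_sumr.
  by apply: eq_bigr => e _ /=; ring.
transitivity (\sum_a P l a * (q * ((r == v)%:R * Q a u + d 0 v * Q a v * (r == u)%:R))).
  apply: eq_bigr => a _; congr (_ * _); rewrite -nuQ -(PQE r v) !mulr_suml -big_split mulr_sumr.
  by apply: eq_bigr => b _ /=; ring.
rewrite -(PQE l u) -(PQE l v) !mulr_sumr mulr_suml -big_split mulr_sumr.
by apply: eq_bigr => a _ /=; ring.
Qed.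

Lemma eigen_tensors : hecke_tensors q (d 0) eigen_c eigen_f.
Proof.
have trD (M : 'M[L]_3) (D : 'rV_3) : P *m M = diag_mx D *m P -> \tr M = \sum_i D 0 i.
  move=> e; rewrite -mxtrace_diag; have -> : diag_mx D = P *m M *m Q by rewrite e -mulmxA PQ mulmx1.
  by rewrite mxtrace_mulC mulmxA QP mul1mx.
split.
- exact: eigen_cycc.
- exact: eigen_rot.
- exact: eigen_inv.
- exact: eigen_bigon.
- exact: eigen_square.
- move=> x h i.
  have sum1 (w : 'I_3 -> L) y z :
      c3 C (\sum_a w a *: row a P) y z = \sum_a w a * c3 C (row a P) y z.
    apply: (big_ind2 (fun u v => c3 C u y z = v)); first exact: c3_0.
      by move=> ? ? ? ? <- <-; exact: c3D.
    by move=> ? _; exact: c3Z.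
  have rowE (w : 'rV_3) : w *m P = \sum_a w 0 a *: row a P by rewrite mulmx_sum_row.
  pose p : 'rV_3 := (\row_a x a) *m P.
  have p0 : p = 0.
    apply: (c3_smooth W) => z; rewrite -(c3_cyc W) -[z]mulmx1 -QP mulmxA rowE sum1.
    rewrite big1 // => k _; rewrite (c3_cyc W).
    have pE : p = \sum_a x a *: row a P.
      by rewrite /p rowE; apply: eq_bigr => a _; rewrite mxE.
    have -> : c3 C p p (row k P) = 0; last by rewrite mulr0.
    rewrite {1}pE sum1 -[RHS](h k); apply: eq_bigr => a _.
    rewrite (c3_cyc W) pE sum1 mulr_sumr; apply: eq_bigr => b _.
    by rewrite /eigen_c (c3_cyc W (row a P)) mulrA.
  have : (\row_a x a) = 0 :> 'rV_3 by rewrite -[LHS]mulmx1 -PQ mulmxA -/p p0 mul0mx.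
  by move/rowP/(_ i); rewrite !mxE.
- exact: d0.
- by rewrite -(trD nu) // (w_tr W).
have -> : \sum_i (d 0 i)^-1 = \tr nuV.
  rewrite (trD _ (\row_x (d 0 x)^-1)); first by apply: eq_bigr => i _; rewrite mxE.
  have e : P = diag_mx d *m (P *m nuV).
    by rewrite mulmxA -Pnu -mulmxA (mulmx1C (w_nuV W)) mulmx1.
  rewrite {2}e mulmxA; have -> : diag_mx (\row_x (d 0 x)^-1) *m diag_mx d = 1%:M.
    apply/matrixP => x y; rewrite mul_diag_mx !mxE.
    have [->|xy] := eqVneq x y; first by rewrite !mulr1n mulVf.
    by rewrite !mulr0n mulr0.
  by rewrite mul1mx.
exact: w_trV W.
Qed.

End BaseChange.

(** * Triviality of the twist *)

Section WebRigid.
Variables (L : closedFieldType) (q : L) (nu nuV : 'M[L]_3) (C G : 'I_3 -> 'M[L]_3).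
Hypotheses (W : web q nu nuV C G) (q0 : q != 0).
Hypotheses (two0 : (2%:R : L) != 0) (three0 : (3%:R : L) != 0).

(** The eigenspace of 1 is a plane, so the linear form c(_, e, e) has a zero in it, namely s e_b - t
    e_a. Taking that vector into the eigenbasis provides the vanishing entry that [no_reflection]
    asks for. *)
Lemma web_no_reflection (P : 'M[L]_3) (d : 'rV[L]_3) (a b e : 'I_3) :
  P \in unitmx -> P *m nu = diag_mx d *m P -> a != b -> a != e -> b != e ->
  d 0 a = 1 -> d 0 b = 1 -> d 0 e = -1 -> False.
Proof.
move=> PU Pnu ab ae be da db de.
have ba : b != a by rewrite eq_sym.
pose s := c3 C (row a P) (row e P) (row e P); pose t := c3 C (row b P) (row e P) (row e P).
have [s0|s0] := eqVneq s 0.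
  exact: (no_reflection (eigen_tensors W PU Pnu) q0 two0 ab ae be da db de s0).
pose P2 : 'M[L]_3 := \matrix_x (if x == b then s *: row b P - t *: row a P else row x P).
have rP x : row x P *m nu = d 0 x *: row x P.
  by rewrite -row_mul Pnu mul_diag_mx; apply/rowP => y; rewrite !mxE.
have P2nu : P2 *m nu = diag_mx d *m P2.
  apply/row_matrixP => x; rewrite row_mul [RHS](_ : _ = d 0 x *: row x P2); last first.
    by rewrite mul_diag_mx; apply/rowP => y; rewrite !mxE.
  rewrite rowK; have [->|xb] := eqVneq x b; last by rewrite rP.
  by rewrite mulmxBl -!scalemxAl !rP da db !scale1r.
have P2U : P2 \in unitmx.
  rewrite -row_free_unit -kermx_eq0; apply/rowV0P => w /sub_kermxP.
  rewrite mulmx_sum_row (sum3 _ ab ae be) !rowK (negbTE ab) eqxx eq_sym (negbTE be) => h.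
  pose w' : 'rV[L]_3 := \row_x
    (if x == a then w 0 a - w 0 b * t else if x == b then w 0 b * s else w 0 e).
  have w'0 : w' = 0.
    have [ea eb ec] : [/\ w' 0 a = w 0 a - w 0 b * t, w' 0 b = w 0 b * s & w' 0 e = w 0 e].
      by rewrite !mxE !eqxx (negbTE ba) (eq_sym e a) (negbTE ae) (eq_sym e b) (negbTE be).
    have w'P : w' *m P = 0.
      rewrite mulmx_sum_row (sum3 _ ab ae be) ea eb ec -[RHS]h.
      by apply/rowP => y; rewrite !mxE; ring.
    by rewrite -[w']mulmx1 -(mulmxV PU) mulmxA w'P mul0mx.
  have := congr1 (fun v : 'rV_3 => (v 0 a, v 0 b, v 0 e)) w'0.
  rewrite /= !mxE !eqxx (negbTE ba) (eq_sym e a) (negbTE ae) (eq_sym e b) (negbTE be).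
  case=> ha hb he.
  have wb : w 0 b = 0 by move/eqP: hb; rewrite mulf_eq0 (negbTE s0) orbF => /eqP.
  have wa : w 0 a = 0 by move: ha; rewrite wb mul0r subr0.
  by apply/rowP => x; rewrite mxE; case: (ord3_cover x ab ae be) => ->.
apply: (no_reflection (eigen_tensors W P2U P2nu) q0 two0 ba be ae db da de).
rewrite /eigen_c !rowK eqxx (eq_sym e b) (negbTE be).
have -> : s *: row b P - t *: row a P = s *: row b P + (- t) *: row a P by rewrite scaleNr.
by rewrite (c3_linl C) (c3Z C) -/s -/t mulNr mulrC addrN.
Qed.

Lemma web_rigid : q = 1 /\ nu = 1%:M.
Proof.
have [P [d [PU Pnu]]] := diagonalizable_no_jordan (web_no_jordan W two0 three0).
have T := eigen_tensors W PU Pnu.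
case: (@eigen_cases _ _ _ _ _ T q0 two0 three0 0 1 (1 + 1)) => // [[q1 d1]|].
  split=> //; have -> : nu = invmx P *m (P *m nu) by rewrite mulmxA mulVmx // mul1mx.
  rewrite Pnu; have -> : diag_mx d = 1%:M.
    by apply/matrixP => i j; rewrite !mxE d1.
  by rewrite mul1mx mulVmx.
case=> a [b [e [ab ae be da [db de]]]].
by case: (web_no_reflection PU Pnu ab ae be da db de).
Qed.

End WebRigid.

(** * From Hecke symmetries to bigon and square identities *)

Lemma sum_mxtens (V : nmodType) m n (F : 'I_(m * n) -> V) :
  \sum_i F i = \sum_i \sum_j F (mxtens_index (i, j)).
Proof.
rewrite pair_big (reindex (@mxtens_index m n)) /=; last first.
  by exists (@mxtens_unindex m n) => i _; rewrite (mxtens_indexK, mxtens_unindexK).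
by apply: eq_bigr => -[].
Qed.

(** In the expansion the mixed quadratic terms agree on both sides, and x^2 = (1 + q) x makes the
    terms of lower degree differ only by q x and q y. *)
Lemma hecke_braid_scalar (L : fieldType) n (q : L) (x y : 'M[L]_n) :
  x *m x = (1 + q) *: x -> y *m y = (1 + q) *: y ->
  (q%:M - x) *m (q%:M - y) *m (q%:M - x) = (q%:M - y) *m (q%:M - x) *m (q%:M - y) ->
  x *m y *m x - q *: x = y *m x *m y - q *: y.
Proof.
move=> xx yy.
have E (a b : 'M[L]_n) : a *m a = (1 + q) *: a ->
    (q%:M - a) *m (q%:M - b) *m (q%:M - a)
    = q *: (q *: q%:M) - q ^+ 2 *: a - q ^+ 2 *: b - q ^+ 2 *: a + q *: (a *m b) + q *: (b *m a)
      + (q * (1 + q)) *: a - a *m b *m a.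
  move=> aa; rewrite !(mulmxBl, mulmxBr) !(mul_scalar_mx, mul_mx_scalar) -!scalemxAl.
  rewrite !(mul_scalar_mx, mul_mx_scalar) aa; move: (a *m b) (b *m a) => ab ba.
  by apply/matrixP => i j; rewrite !mxE; ring.
rewrite !E // => /matrixP h; apply/matrixP => i j; have := h i j.
move: (x *m y *m x) (y *m x *m y) (x *m y) (y *m x) => xyx yxy xy yx.
rewrite !mxE => e; apply: (eq_lin (-1) e); ring.
Qed.

Definition i3 (x y z : 'I_3) : 'I_(3 * 3 * 3) := mxtens_index (mxtens_index (x, y), z).

Lemma R12E (L : fieldType) (R : 'M[L]_(3 * 3)) x y z x' y' z' :
  R12 R (i3 x y z) (i3 x' y' z')
  = R (mxtens_index (x, y)) (mxtens_index (x', y')) * (z == z')%:R.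
Proof. by rewrite /R12 tensmxE mxE. Qed.

Lemma R23E (L : fieldType) (R : 'M[L]_(3 * 3)) x y z x' y' z' :
  R23 R (i3 x y z) (i3 x' y' z')
  = (x == x')%:R * R (mxtens_index (y, z)) (mxtens_index (y', z')).
Proof.
have e a b c : cast_ord (esym (mulnA 3 3 3)) (i3 a b c)
    = mxtens_index (a, mxtens_index (b, c)).
  by apply: val_inj => /=; rewrite !mulnDl -mulnA addnA.
by rewrite /R23 castmxE !e tensmxE mxE.
Qed.

Lemma castmx_mulmx (L : fieldType) m m' (e : m = m') (M N : 'M[L]_m) :
  castmx (e, e) M *m castmx (e, e) N = castmx (e, e) (M *m N).
Proof. by case: m' / e; rewrite !castmx_id. Qed.

Lemma R12_mul (L : fieldType) (M N : 'M[L]_(3 * 3)) : R12 M *m R12 N = R12 (M *m N).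
Proof. by rewrite /R12 tensmx_mul mulmx1. Qed.

Lemma R23_mul (L : fieldType) (M N : 'M[L]_(3 * 3)) : R23 M *m R23 N = R23 (M *m N).
Proof. by rewrite /R23 castmx_mulmx tensmx_mul mulmx1. Qed.

Lemma i3P (w : 'I_(3 * 3 * 3)) : exists x y z, w = i3 x y z.
Proof.
by case: (mxtens_indexP w) => xy z; case: (mxtens_indexP xy) => x y; exists x, y, z.
Qed.

Lemma i3_eq x y z x' y' z' : (i3 x y z == i3 x' y' z') = [&& x == x', y == y' & z == z'].
Proof. by rewrite !(can_eq (@mxtens_indexK _ _)) xpair_eqE (can_eq (@mxtens_indexK _ _)) xpair_eqE andbA. Qed.

Lemma i2_eq (x y x' y' : 'I_3) :
  (mxtens_index (x, y) == mxtens_index (x', y')) = (x == x') && (y == y').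
Proof. by rewrite (can_eq (@mxtens_indexK _ _)) xpair_eqE. Qed.

Lemma R12_lin (L : fieldType) (a b : L) (M : 'M[L]_(3 * 3)) :
  R12 (a%:M + b *: M) = a%:M + b *: R12 M.
Proof.
apply/matrixP => u w; have [x [y [z ->]]] := i3P u; have [x' [y' [z' ->]]] := i3P w.
rewrite [RHS]mxE [(b *: R12 M) _ _]mxE !R12E !mxE i3_eq i2_eq.
by rewrite -!(mulr_natr a) andbA -!mulnb !natrM; ring.
Qed.

Lemma R23_lin (L : fieldType) (a b : L) (M : 'M[L]_(3 * 3)) :
  R23 (a%:M + b *: M) = a%:M + b *: R23 M.
Proof.
apply/matrixP => u w; have [x [y [z ->]]] := i3P u; have [x' [y' [z' ->]]] := i3P w.
rewrite [RHS]mxE [(b *: R23 M) _ _]mxE !R23E !mxE i3_eq i2_eq.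
by rewrite -!(mulr_natr a) -!mulnb !natrM; ring.
Qed.

Section Braid.
Variables (L : fieldType) (q : L) (R : 'M[L]_(3 * 3)).
Hypothesis hR : hecke_symmetry q R.
Let B := q%:M - R.

Lemma hecke_idem : B *m B = (1 + q) *: B.
Proof.
have [_ h] := hR; have e : B *m B = (1 + q) *: B + (R - q%:M) *m (R + 1%:M).
  rewrite /B !(mulmxBl, mulmxBr, mulmxDr, mulmxDl) !(mul_scalar_mx, mul_mx_scalar).
  by apply/matrixP => i j; rewrite !mxE; ring.
by rewrite e h addr0.
Qed.

Lemma hecke_braid :
  R12 B *m R23 B *m R12 B - q *: R12 B = R23 B *m R12 B *m R23 B - q *: R23 B.
Proof.
have s2 a (M : 'M[L]_(3 * 3)) : R12 (a *: M) = a *: R12 M.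
  by have := R12_lin 0 a M; rewrite !raddf0 !add0r.
have s3 a (M : 'M[L]_(3 * 3)) : R23 (a *: M) = a *: R23 M.
  by have := R23_lin 0 a M; rewrite !raddf0 !add0r.
have RB : R = q%:M + (-1) *: B by rewrite /B scaleN1r opprB addrC subrK.
apply: hecke_braid_scalar.
- by rewrite R12_mul hecke_idem s2.
- by rewrite R23_mul hecke_idem s3.
have [h _] := hR; move: h; rewrite {1 2 3 4 5 6}RB !R12_lin !R23_lin !scaleN1r.
by [].
Qed.

End Braid.

Lemma sum_front4 (V : nmodType) (F : 'I_3 -> 'I_3 -> 'I_3 -> 'I_3 -> V) :
  \sum_p \sum_r \sum_s \sum_i F p r s i = \sum_i \sum_p \sum_r \sum_s F p r s i.
Proof.
under eq_bigr do (under eq_bigr do rewrite exchange_big); under eq_bigr do rewrite exchange_big.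
by rewrite exchange_big.
Qed.

Lemma R12_mulE (L : fieldType) (M : 'M[L]_(3 * 3)) (N : 'M[L]_(3 * 3 * 3)) x y z w :
  (R12 M *m N) (i3 x y z) w
  = \sum_p \sum_r M (mxtens_index (x, y)) (mxtens_index (p, r)) * N (i3 p r z) w.
Proof.
rewrite mxE sum_mxtens sum_mxtens; apply: eq_bigr => p _; apply: eq_bigr => r _.
under eq_bigr do rewrite R12E -mulrA mulrCA mulrC.
by rewrite -[RHS](sum_delta' (fun t => _ * N (i3 p r t) w)); apply: eq_bigr => t _; ring.
Qed.

Lemma R23_mulE (L : fieldType) (M : 'M[L]_(3 * 3)) (N : 'M[L]_(3 * 3 * 3)) x y z w :
  (R23 M *m N) (i3 x y z) w
  = \sum_p \sum_r M (mxtens_index (y, z)) (mxtens_index (p, r)) * N (i3 x p r) w.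
Proof.
rewrite mxE sum_mxtens sum_mxtens exchange_big; apply: eq_bigr => p _ /=.
rewrite exchange_big; apply: eq_bigr => r _ /=.
under eq_bigr do rewrite R23E -mulrA mulrC.
by rewrite sum_delta'.
Qed.

Lemma mul_sum3 (L : comPzRingType) (a b e : 'I_3 -> L) :
  (\sum_i a i) * (\sum_j b j) * (\sum_u e u) = \sum_i \sum_u \sum_j a i * b j * e u.
Proof.
rewrite !mulr_suml; apply: eq_bigr => i _; rewrite mulr_sumr; apply: eq_bigr => u _.
by rewrite mulr_sumr mulr_suml.
Qed.

Section Entries.
Variables (L : fieldType) (C G : 'I_3 -> 'M[L]_3) (B : 'M[L]_(3 * 3)).
Hypothesis C_cyc : forall i m n, C i m n = C m n i.
Hypothesis BE : forall x y k l,
  B (mxtens_index (x, y)) (mxtens_index (k, l)) = \sum_j G j x y * C j k l.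

(** As B factors through V, the three factors share inner legs that close up into a trace; an outer
    G and an outer C remain. *)
Lemma braid12E x y z x' y' z' :
  (R12 B *m R23 B *m R12 B) (i3 x y z) (i3 x' y' z')
  = \sum_i \sum_u G i x y * \tr (C i *m Phi G z *m C z' *m (G u)^T) * C u x' y'.
Proof.
transitivity (\sum_p \sum_r \sum_s \sum_i \sum_u \sum_j
    G i x y * (C i p r * G j r z * C z' j s * G u p s) * C u x' y').
  rewrite -mulmxA R12_mulE; apply: eq_bigr => p _; apply: eq_bigr => r _.
  rewrite R23_mulE mulr_sumr; apply: eq_bigr => s _.
  under eq_bigr do rewrite R12E mulrA.
  rewrite sum_delta !BE.
  transitivity ((\sum_i G i x y * C i p r) * (\sum_j G j r z * C j s z')
    * (\sum_u G u p s * C u x' y')); first by ring.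
  rewrite mul_sum3; apply: eq_bigr => i _; apply: eq_bigr => u _; apply: eq_bigr => j _.
  by rewrite (C_cyc z'); ring.
rewrite sum_front4; apply: eq_bigr => i _; rewrite sum_front4; apply: eq_bigr => u _.
rewrite trace_mul4E mulr_sumr mulr_suml; apply: eq_bigr => p _.
rewrite mulr_sumr mulr_suml; apply: eq_bigr => r _.
rewrite mulr_sumr mulr_suml exchange_big; apply: eq_bigr => j _.
rewrite mulr_sumr mulr_suml; apply: eq_bigr => s _.
by rewrite mxE.
Qed.

Lemma braid23E x y z x' y' z' :
  (R23 B *m R12 B *m R23 B) (i3 x y z) (i3 x' y' z')
  = \sum_i \sum_u G i y z * \tr (C i *m (G u)^T *m C x' *m Phi' G x) * C u y' z'.
Proof.
transitivity (\sum_p \sum_r \sum_t \sum_i \sum_u \sum_j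
    G i y z * (C i p r * G u t r * C x' t j * G j x p) * C u y' z').
  rewrite -mulmxA R23_mulE; apply: eq_bigr => p _; apply: eq_bigr => r _.
  rewrite R12_mulE exchange_big mulr_sumr; apply: eq_bigr => t _ /=.
  have -> : \sum_s B (mxtens_index (x, p)) (mxtens_index (s, t)) * R23 B (i3 s t r) (i3 x' y' z')
      = B (mxtens_index (x, p)) (mxtens_index (x', t)) * B (mxtens_index (t, r)) (mxtens_index (y', z')).
    rewrite -[RHS](sum_delta (fun s => B (mxtens_index (x, p)) (mxtens_index (s, t))
      * B (mxtens_index (t, r)) (mxtens_index (y', z')))).
    by apply: eq_bigr => s _; rewrite R23E; ring.
  rewrite !BE.
  transitivity ((\sum_i G i y z * C i p r) * (\sum_j G j x p * C j x' t)
    * (\sum_u G u t r * C u y' z')); first by ring.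
  rewrite mul_sum3; apply: eq_bigr => i _; apply: eq_bigr => u _; apply: eq_bigr => j _.
  by rewrite (C_cyc j); ring.
rewrite sum_front4; apply: eq_bigr => i _; rewrite sum_front4; apply: eq_bigr => u _.
rewrite -[Phi' G x]trmxK trace_mul4E mulr_sumr mulr_suml; apply: eq_bigr => p _.
rewrite mulr_sumr mulr_suml; apply: eq_bigr => r _.
rewrite mulr_sumr mulr_suml; apply: eq_bigr => t _.
rewrite mulr_sumr mulr_suml; apply: eq_bigr => j _.
by rewrite !mxE.
Qed.

End Entries.

Lemma sum_sub_delta (L : comPzRingType) (q b : L) (g h : 'I_3 -> L) (T : 'I_3 -> 'I_3 -> L) :
  \sum_u (\sum_i g i * (T i u - q * (b * (i == u)%:R))) * h u
  = \sum_i \sum_u g i * T i u * h u - q * ((\sum_j g j * h j) * b).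
Proof.
transitivity (\sum_u (\sum_i g i * T i u * h u - q * (g u * h u * b))); last first.
  by rewrite sumrB exchange_big mulr_suml mulr_sumr.
apply: eq_bigr => u _; rewrite -(sum_delta g u) !mulr_suml mulr_sumr -sumrB.
by apply: eq_bigr => i _; ring.
Qed.

Section FromHecke.
Variables (L : fieldType) (q : L) (R : 'M[L]_(3 * 3)) (C : 'I_3 -> 'M[L]_3).
Variable S : 'M[L]_(3, 3 * 3).
Hypothesis hR : hecke_symmetry q R.
Hypothesis SE : forall i m n, S i (mxtens_index (m, n)) = C i m n.
Hypothesis RS : (R - q%:M == S)%MS.
Hypothesis C_cyc : forall i m n, C i m n = C m n i.
Hypothesis C_inj : forall x : 'I_3 -> L, \sum_i x i *: C i = 0 -> forall i, x i = 0.
Hypothesis C_koszul : forall t t' : 'I_3 -> 'I_3 -> L,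
  (forall m n s, \sum_u t u s * C u m n = \sum_u t' m u * C u n s) ->
  exists y, forall u s, t u s = y * (u == s)%:R /\ t' s u = y * (u == s)%:R.

Let B := q%:M - R.

Let S_free (v : 'rV[L]_3) : v *m S = 0 -> v = 0.
Proof.
move=> h; apply/rowP => i; rewrite mxE; apply: (C_inj (x := v 0)); apply/matrixP => m n.
have := congr1 (fun w : 'rV_(3 * 3) => w 0 (mxtens_index (m, n))) h.
rewrite /= !mxE => <-; rewrite summxE; apply: eq_bigr => a _.
by rewrite mxE SE.
Qed.

(** With x, y, z fixed, the two sides of the braid relation are vectors of W (x) V and of V (x) W,
    so [C_koszul] reduces both coefficient matrices to one scalar w(x, y, z). Contracting with [E]
    strips the outer G and turns w into X and X'. *)
Lemma hecke_web_data : exists (G : 'I_3 -> 'M[L]_3) (X X' : 'M[L]_3),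
  [/\ forall i u, \tr (C i *m (G u)^T) = (1 + q) * (i == u)%:R,
      forall l v r u, \tr (C l *m Phi G v *m C r *m (G u)^T)
        = q * ((r == v)%:R * (l == u)%:R) + (r == u)%:R * X l v
    & forall l u r x, \tr (C l *m (G u)^T *m C r *m Phi' G x)
        = q * ((r == x)%:R * (l == u)%:R) + (r == u)%:R * X' l x].
Proof.
have BS : (B <= S)%MS.
  have -> : B = - (R - q%:M) by rewrite opprB.
  by rewrite (eqmx_opp _) (eqmxP RS).
have SB : (S <= B)%MS.
  have -> : B = - (R - q%:M) by rewrite opprB.
  by rewrite (eqmx_opp _) -(eqmxP RS).
have [D BD] := submxP BS; have [E SEq] := submxP SB.
have free (M : 'M[L]_3) : M *m S = 0 -> M = 0.
  by move=> h; apply/row_matrixP => i; rewrite row0; apply: S_free; rewrite -row_mul h row0.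
(* S = E B = E D S and the rows of S are independent. This left inverse is available even when 1 + q
   = 0, where S D vanishes. *)
have ED : E *m D = 1%:M.
  apply/eqP; rewrite -subr_eq0; apply/eqP; apply: free.
  by rewrite mulmxBl -mulmxA -BD -SEq mul1mx subrr.
have SD : S *m D = (1 + q)%:M.
  have h : (D *m (S *m D) *m S) = (1 + q) *: (D *m S).
    by rewrite !mulmxA -BD -mulmxA -BD (hecke_idem hR).
  apply/eqP; rewrite -subr_eq0; apply/eqP; apply: free.
  rewrite -[X in X *m S]mul1mx -ED -(mulmxA E) mulmxBr.
  by rewrite -mulmxA mulmxBl h mul_mx_scalar -scalemxAl subrr mulmx0.
pose G u : 'M[L]_3 := \matrix_(m, n) D (mxtens_index (m, n)) u.
have BE x y k l : B (mxtens_index (x, y)) (mxtens_index (k, l)) = \sum_j G j x y * C j k l.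
  by rewrite {1}BD mxE; apply: eq_bigr => j _; rewrite mxE SE.
(* The defects of the two square identities. *)
pose s1 i z z' u := \tr (C i *m Phi G z *m C z' *m (G u)^T) - q * ((z' == z)%:R * (i == u)%:R).
pose s2 i u x' x := \tr (C i *m (G u)^T *m C x' *m Phi' G x) - q * ((x' == x)%:R * (i == u)%:R).
have br x y z x' y' z' :
    \sum_u (\sum_i G i x y * s1 i z z' u) * C u x' y'
    = \sum_u (\sum_i G i y z * s2 i u x' x) * C u y' z'.
  have /matrixP /(_ (i3 x y z) (i3 x' y' z')) := hecke_braid hR.
  have aux (M N : 'M[L]_(3 * 3 * 3)) i j : (M - q *: N) i j = M i j - q * N i j by rewrite !mxE.
  rewrite !aux -/B (braid12E C_cyc BE) (braid23E C_cyc BE) R12E R23E !BE => h.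
  rewrite /s1 /s2 sum_sub_delta sum_sub_delta (eq_sym z') (eq_sym x') h.
  by rewrite [(x == x')%:R * _]mulrC.
have psi x y z : exists w, (forall z' u, \sum_i G i x y * s1 i z z' u = w * (u == z')%:R)
    /\ (forall x' u, \sum_i G i y z * s2 i u x' x = w * (u == x')%:R).
  have [w hw] := C_koszul (t := fun u z' => \sum_i G i x y * s1 i z z' u)
    (t' := fun x' u => \sum_i G i y z * s2 i u x' x) (fun m n s => br x y z m n s).
  by exists w; split=> a b; have [] := hw b a.
pose w x y z := \sum_i G i x y * s1 i z 0 0.
have w1 x y z z' u : \sum_i G i x y * s1 i z z' u = w x y z * (u == z')%:R.
  have [v [h1 _]] := psi x y z.
  by rewrite /w !h1 eqxx mulr1.
have w2 x y z x' u : \sum_i G i y z * s2 i u x' x = w x y z * (u == x')%:R.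
  have [v [h1 h2]] := psi x y z.
  by rewrite /w h1 h2 eqxx mulr1.
have EG k (g : 'I_3 -> L) :
    \sum_x \sum_y E k (mxtens_index (x, y)) * \sum_i G i x y * g i = g k.
  transitivity (\sum_i (\sum_x \sum_y E k (mxtens_index (x, y)) * G i x y) * g i).
    under [RHS]eq_bigr do rewrite mulr_suml; rewrite [RHS]exchange_big; apply: eq_bigr => x _.
    under [RHS]eq_bigr do rewrite mulr_suml; rewrite [RHS]exchange_big; apply: eq_bigr => y _.
    by rewrite mulr_sumr; apply: eq_bigr => i _; rewrite mulrA.
  rewrite -(sum_delta' g k); apply: eq_bigr => i _; rewrite mulrC; congr (_ * _).
  have := congr1 (fun M : 'M_3 => M k i) ED; rewrite /= !mxE sum_mxtens => <-.
  by apply: eq_bigr => x _; apply: eq_bigr => y _; rewrite mxE.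
exists G, (\matrix_(k, z) \sum_x \sum_y E k (mxtens_index (x, y)) * w x y z),
  (\matrix_(k, x) \sum_y \sum_z E k (mxtens_index (y, z)) * w x y z); split.
- move=> i u; have := congr1 (fun M : 'M_3 => M i u) SD; rewrite /= !mxE sum_mxtens.
  rewrite mulr_natr => <-; rewrite mxtrace_mulE; apply: eq_bigr => m _; apply: eq_bigr => n _.
  by rewrite !mxE SE.
- move=> l v r u; rewrite mxE.
  transitivity (q * ((r == v)%:R * (l == u)%:R) + s1 l v r u); first by rewrite /s1; ring.
  congr (_ + _); rewrite -(EG l (fun i => s1 i v r u)) mulr_sumr; apply: eq_bigr => x _.
  rewrite mulr_sumr; apply: eq_bigr => y _; rewrite w1 (eq_sym u); ring.
move=> l u r x; rewrite mxE.
transitivity (q * ((r == x)%:R * (l == u)%:R) + s2 l u r x); first by rewrite /s2; ring.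
congr (_ + _); rewrite -(EG l (fun i => s2 i u r x)) mulr_sumr; apply: eq_bigr => y _.
by rewrite mulr_sumr; apply: eq_bigr => z _; rewrite (w2 x) (eq_sym u); ring.
Qed.

End FromHecke.

(** * Sklyanin relations and conclusion *)

Section SklKoszul.
Variables (L : fieldType) (a b c : L).
Hypotheses (abc0 : a * b * c != 0)
  (skl_gen : (a ^+ 3 + b ^+ 3 + c ^+ 3) ^+ 3 != 27%:R * a ^+ 3 * b ^+ 3 * c ^+ 3).

Let a0 : a != 0. Proof. by move: abc0; rewrite !mulf_eq0 !negb_or => /andP [/andP []]. Qed.
Let b0 : b != 0. Proof. by move: abc0; rewrite !mulf_eq0 !negb_or => /andP [/andP []]. Qed.
Let c0 : c != 0. Proof. by move: abc0; rewrite !mulf_eq0 !negb_or => /andP []. Qed.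

(** Eliminating the primed unknowns links x, y, z by monomial factors, and consistency around the
    cycle with x nonzero would give a^3 = b^3 = c^3. The off-diagonal unknowns of [skl_koszul]
    satisfy six instances of this system. *)
Lemma shift_system_eq0 (x y z x' y' z' : L) :
  a * x = b * x' -> a * y = b * y' -> a * z = b * z' ->
  b * x = c * y' -> b * y = c * z' -> b * z = c * x' ->
  c * x = a * z' -> c * y = a * x' -> c * z = a * y' -> x = 0 /\ x' = 0.
Proof.
move=> x1 y1 z1 x2 y2 z2 x3 y3 z3.
have hA : b ^+ 2 * x = a * c * y by apply: (eq_lin b x2); apply: (eq_lin (- c) y1); ring.
have hB : b ^+ 2 * y = a * c * z by apply: (eq_lin b y2); apply: (eq_lin (- c) z1); ring.
have hC : b ^+ 2 * z = a * c * x by apply: (eq_lin b z2); apply: (eq_lin (- c) x1); ring.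
have hD : b * c * x = a ^+ 2 * z by apply: (eq_lin b x3); apply: (eq_lin (- a) z1); ring.
have x_0 : x = 0.
  apply/eqP/negPn/negP => xn0; apply: (not_all_cubes_eq skl_gen); split.
    apply: (mulfI c0); apply: (mulIf xn0).
    by apply: (eq_lin (- a ^+ 2) hC); apply: (eq_lin (- b ^+ 2) hD); ring.
  apply: (mulfI b0); apply: (mulIf xn0).
  apply: (eq_lin (b ^+ 2) hA); apply: (eq_lin (a * c) hB).
  by apply: (eq_lin (- c ^+ 2) hD); ring.
by split=> //; apply: (mulfI b0); rewrite -x1 x_0 !mulr0.
Qed.

Lemma skl_inj (x : 'I_3 -> L) i : (forall m n, \sum_i x i * skl a b c i m n = 0) -> x i = 0.
Proof.
move=> h; apply: (mulIf c0); rewrite mul0r -[RHS](h i i) (bigD1 i) //= big1 => [|j ji].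
  rewrite /skl !eqxx; case: i => [[|[|[|?]]] ?] //=; ring.
by rewrite /skl; case: i j ji => [[|[|[|?]]] ?] [[|[|[|?]]] ?] //= _; ring.
Qed.

Let i0 := @Ordinal 3 0 isT.
Let i1 := @Ordinal 3 1 isT.
Let i2 := @Ordinal 3 2 isT.
Let e01 : i0 != i1. Proof. by []. Qed.
Let e02 : i0 != i2. Proof. by []. Qed.
Let e12 : i1 != i2. Proof. by []. Qed.

Let cover (Pr : 'I_3 -> Prop) : Pr i0 -> Pr i1 -> Pr i2 -> forall x, Pr x.
Proof. by move=> ? ? ? x; case: (ord3_cover x e01 e02 e12) => ->. Qed.

Let sklE : ((skl a b c i0 i1 i2 = a) * (skl a b c i1 i2 i0 = a) * (skl a b c i2 i0 i1 = a)
   * (skl a b c i0 i2 i1 = b) * (skl a b c i1 i0 i2 = b) * (skl a b c i2 i1 i0 = b)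
   * (skl a b c i0 i0 i0 = c) * (skl a b c i1 i1 i1 = c) * (skl a b c i2 i2 i2 = c)
   * (skl a b c i0 i0 i1 = 0) * (skl a b c i0 i1 i0 = 0) * (skl a b c i1 i0 i0 = 0)
   * (skl a b c i0 i0 i2 = 0) * (skl a b c i0 i2 i0 = 0) * (skl a b c i2 i0 i0 = 0)
   * (skl a b c i1 i1 i0 = 0) * (skl a b c i1 i0 i1 = 0) * (skl a b c i0 i1 i1 = 0)
   * (skl a b c i1 i1 i2 = 0) * (skl a b c i1 i2 i1 = 0) * (skl a b c i2 i1 i1 = 0)
   * (skl a b c i2 i2 i0 = 0) * (skl a b c i2 i0 i2 = 0) * (skl a b c i0 i2 i2 = 0)
   * (skl a b c i2 i2 i1 = 0) * (skl a b c i2 i1 i2 = 0) * (skl a b c i1 i2 i2 = 0))%type.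
Proof. by do !split; rewrite /skl /= ?mulr0 ?mulr1 ?addr0 ?add0r. Qed.

(** The equations are c x_i^2 = - (a + b) x_j x_k. Their product gives (c^3 + (a + b)^3) (x_0 x_1
    x_2)^2 = 0, and once x_0 x_1 x_2 = 0 each cube c x_i^3 vanishes. *)
Lemma skl_smooth (x : 'I_3 -> L) :
  (forall k, \sum_i \sum_j x i * x j * skl a b c i j k = 0) -> forall i, x i = 0.
Proof.
move=> h; have := (h i0, h i1, h i2).
rewrite !(sum3 _ e01 e02 e12) !sklE => -[[h0 h1] h2].
have g0 : c * x i0 ^+ 2 = - (a + b) * (x i1 * x i2) by apply: (eq_lin 1 h0); ring.
have g1 : c * x i1 ^+ 2 = - (a + b) * (x i0 * x i2) by apply: (eq_lin 1 h1); ring.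
have g2 : c * x i2 ^+ 2 = - (a + b) * (x i0 * x i1) by apply: (eq_lin 1 h2); ring.
have p0 : x i0 * x i1 * x i2 = 0.
  apply/eqP; rewrite -sqrf_eq0; apply/eqP.
  apply: (mulfI (hesse_smooth skl_gen)); rewrite mulr0.
  transitivity ((c * x i0 ^+ 2) * (c * x i1 ^+ 2) * (c * x i2 ^+ 2)
     + (a + b) ^+ 3 * (x i0 * x i1 * x i2) ^+ 2); first by ring.
  by rewrite g0 g1 g2; ring.
have cube (y : L) : c * y ^+ 3 = 0 -> y = 0.
  by move/eqP; rewrite mulf_eq0 (negbTE c0) expf_eq0 /= => /eqP.
apply: cover; apply: cube.
- by rewrite exprS mulrCA g0; transitivity (- (a + b) * (x i0 * x i1 * x i2)); [ring | rewrite p0 mulr0].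
- by rewrite exprS mulrCA g1; transitivity (- (a + b) * (x i0 * x i1 * x i2)); [ring | rewrite p0 mulr0].
- by rewrite exprS mulrCA g2; transitivity (- (a + b) * (x i0 * x i1 * x i2)); [ring | rewrite p0 mulr0].
Qed.

(* W (x) V and V (x) W meet in the line spanned by the potential. *)
Lemma skl_koszul (t t' : 'I_3 -> 'I_3 -> L) :
  (forall m n s, \sum_u t u s * skl a b c u m n = \sum_u t' m u * skl a b c u n s) ->
  exists y, forall u s, t u s = y * (u == s)%:R /\ t' s u = y * (u == s)%:R.
Proof.
move=> h; have E m n s := h m n s.
have e := (E i0 i0 i0, E i1 i1 i1, E i2 i2 i2, E i1 i2 i0, E i2 i0 i1, E i0 i1 i2).
move: e; rewrite !(sum3 _ e01 e02 e12) !sklE !(mulr0, addr0, add0r).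
case=> [[[[[f0 f1] f2] f3] f4] f5].
have e1 := (E i0 i1 i0, E i1 i2 i1, E i2 i0 i2, E i1 i0 i0, E i2 i1 i1, E i0 i2 i2, E i2 i2 i0, E i0 i0 i1, E i1 i1 i2).
move: e1; rewrite !(sum3 _ e01 e02 e12) !sklE !(mulr0, addr0, add0r) !(mulrC _ a, mulrC _ b, mulrC _ c).
case=> [[[[[[[[p1 p2] p3] p4] p5] p6] p7] p8] p9].
have e2 := (E i0 i2 i0, E i1 i0 i1, E i2 i1 i2, E i1 i1 i0, E i2 i2 i1, E i0 i0 i2, E i2 i0 i0, E i0 i1 i1, E i1 i2 i2).
move: e2; rewrite !(sum3 _ e01 e02 e12) !sklE !(mulr0, addr0, add0r) !(mulrC _ a, mulrC _ b, mulrC _ c).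
case=> [[[[[[[[r1 r2] r3] r4] r5] r6] r7] r8] r9].
have [t20 t'02] := shift_system_eq0 p1 p2 p3 p4 p5 p6 p7 p8 p9.
have [t01 t'10] := shift_system_eq0 p2 p3 p1 p5 p6 p4 p8 p9 p7.
have [t12 t'21] := shift_system_eq0 p3 p1 p2 p6 p4 p5 p9 p7 p8.
(* The same system with t and t' exchanged, hence the reversed equations. *)
have [t'01 t10] := shift_system_eq0 (esym r1) (esym r3) (esym r2) (esym r6) (esym r5) (esym r4)
  (esym r8) (esym r7) (esym r9).
have [t'20 t02] := shift_system_eq0 (esym r3) (esym r2) (esym r1) (esym r5) (esym r4) (esym r6)
  (esym r7) (esym r9) (esym r8).
have [t'12 t21] := shift_system_eq0 (esym r2) (esym r1) (esym r3) (esym r4) (esym r6) (esym r5)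
  (esym r9) (esym r8) (esym r7).
have g0 := mulIf c0 f0; have g1 := mulIf c0 f1; have g2 := mulIf c0 f2.
have g3 := mulIf a0 f3; have g4 := mulIf a0 f4; have g5 := mulIf a0 f5.
have h1 : t i1 i1 = t i0 i0 by rewrite g3 -g1.
have h2 : t i2 i2 = t i0 i0 by rewrite g5 -g0.
exists (t i0 i0); apply: cover; apply: cover; split; rewrite /= ?mulr0 ?mulr1 //.
by rewrite -g2.
Qed.

End SklKoszul.

(** * Conjugation and extension of scalars *)

Lemma R23_castmx (L : fieldType) (g : 'M[L]_3) :
  castmx (mulnA 3 3 3, mulnA 3 3 3) (g *t (g *t g)) = g *t g *t g.
Proof.
have e x y z : cast_ord (esym (mulnA 3 3 3)) (i3 x y z)
    = mxtens_index (x, mxtens_index (y, z)).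
  by apply: val_inj => /=; rewrite !mulnDl -mulnA addnA.
apply/matrixP => u w; have [x [y [z ->]]] := i3P u; have [x' [y' [z' ->]]] := i3P w.
by rewrite castmxE !e !tensmxE mulrA.
Qed.

Lemma tensmx11 (L : fieldType) m n : (1%:M : 'M[L]_m) *t (1%:M : 'M[L]_n) = 1%:M.
Proof.
apply/matrixP => i j; case: (mxtens_indexP i) => i0 i1; case: (mxtens_indexP j) => j0 j1.
by rewrite tensmxE !mxE (can_eq (@mxtens_indexK _ _)) xpair_eqE -mulnb natrM.
Qed.

Lemma castmx1 (L : fieldType) m n (e : m = n) : castmx (e, e) (1%:M : 'M[L]_m) = 1%:M.
Proof. by case: n / e; rewrite castmx_id. Qed.

Lemma hecke_symmetry_conj (L : fieldType) (q : L) (R : 'M[L]_(3 * 3)) (g : 'M[L]_3) :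
  g \in unitmx -> hecke_symmetry q R ->
  hecke_symmetry q (invmx (g *t g) *m R *m (g *t g)).
Proof.
move=> gU [h1 h2]; set T := g *t g.
have TU : T \in unitmx by apply: tensmx_unit.
pose T3 := T *t g; pose T3i := invmx T *t invmx g.
have T3K : T3 *m T3i = 1%:M by rewrite tensmx_mul !mulmxV ?tensmx11.
have e12 : R12 (invmx T *m R *m T) = T3i *m R12 R *m T3.
  by rewrite /R12 !tensmx_mul mulmx1 mulVmx.
have T3E : T3 = castmx (mulnA 3 3 3, mulnA 3 3 3) (g *t T) by rewrite R23_castmx.
have T3iE : T3i = castmx (mulnA 3 3 3, mulnA 3 3 3) (invmx g *t invmx T).
  rewrite -[RHS]mulmx1 -T3K mulmxA [in RHS]T3E castmx_mulmx tensmx_mul !mulVmx // tensmx11.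
  by rewrite castmx1 mul1mx.
have e23 : R23 (invmx T *m R *m T) = T3i *m R23 R *m T3.
  by rewrite T3iE T3E /R23 !castmx_mulmx !tensmx_mul mulmx1 mulVmx.
split.
  rewrite e12 e23.
  have E (A B D : 'M[L]_(3 * 3 * 3)) :
      T3i *m A *m T3 *m (T3i *m B *m T3) *m (T3i *m D *m T3) = T3i *m (A *m B *m D) *m T3.
    by rewrite !mulmxA -(mulmxA (T3i *m A)) T3K mulmx1 -(mulmxA _ T3 T3i) T3K mulmx1.
  by rewrite !E h1.
have E (x : L) : invmx T *m R *m T + x%:M = invmx T *m (R + x%:M) *m T.
  by rewrite mulmxDr mulmxDl mul_mx_scalar -scalemxAl mulVmx // scalemx1.
have -> : invmx T *m R *m T - q%:M = invmx T *m (R - q%:M) *m T.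
  have -> : - q%:M = (- q)%:M :> 'M[L]_(3 * 3) by rewrite raddfN.
  exact: E.
by rewrite E !mulmxA mulmxK // -(mulmxA (invmx T) _ (R + _)) h2 mulmx0 mul0mx.
Qed.

Lemma hecke_symmetry_map (k L : fieldType) (f : {rmorphism k -> L}) q (R : 'M[k]_(3 * 3)) :
  hecke_symmetry q R -> hecke_symmetry (f q) (map_mx f R).
Proof.
have e12 : R12 (map_mx f R) = map_mx f (R12 R) by rewrite /R12 map_mxT map_mx1.
have e23 : R23 (map_mx f R) = map_mx f (R23 R) by rewrite /R23 map_castmx map_mxT map_mx1.
case=> h1 h2; split; first by rewrite e12 e23 -!map_mxM h1.
by rewrite -map_scalar_mx -map_mxB -(map_mx1 f) -map_mxD -map_mxM h2 map_mx0.
Qed.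

Lemma eigen_c1 (L : fieldType) (C : 'I_3 -> 'M[L]_3) i m n : eigen_c C 1%:M i m n = C i m n.
Proof.
rewrite /eigen_c /c3 -[RHS](sum_delta' (fun a => C a m n)); apply: eq_bigr => a _.
rewrite -[C a m n](sum_delta' (fun b => C a b n)) mulr_suml; apply: eq_bigr => b _.
rewrite -[C a b n](sum_delta' (C a b)) !mulr_suml; apply: eq_bigr => e _.
by rewrite !mxE; ring.
Qed.

Section NoSklyanin.
Variables (L : closedFieldType) (q a b c : L) (R : 'M[L]_(3 * 3)).
Hypotheses (two0 : (2%:R : L) != 0) (three0 : (3%:R : L) != 0) (q0 : q != 0).
Hypotheses (abc0 : a * b * c != 0)
  (skl_gen : (a ^+ 3 + b ^+ 3 + c ^+ 3) ^+ 3 != 27%:R * a ^+ 3 * b ^+ 3 * c ^+ 3).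

Lemma hecke_not_sklyanin :
  hecke_symmetry q R -> ~ (R - q%:M == skl_relations a b c)%MS.
Proof.
move=> hR RS; pose C i : 'M[L]_3 := \matrix_(m, n) skl a b c i m n.
have CE i m n : C i m n = skl a b c i m n by rewrite mxE.
have C_cyc i m n : C i m n = C m n i by rewrite !CE skl_cyc.
have C_inj (x : 'I_3 -> L) : \sum_i x i *: C i = 0 -> forall i, x i = 0.
  move=> h i; apply: (skl_inj abc0) => m n.
  transitivity ((\sum_j x j *: C j) m n); last by rewrite h mxE.
  by rewrite summxE; apply: eq_bigr => j _; rewrite [RHS]mxE CE.
have C_koszul (t t' : 'I_3 -> 'I_3 -> L) :
    (forall m n s, \sum_u t u s * C u m n = \sum_u t' m u * C u n s) ->
    exists y, forall u s, t u s = y * (u == s)%:R /\ t' s u = y * (u == s)%:R.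
  move=> h; apply: (skl_koszul abc0 skl_gen) => m n s.
  transitivity (\sum_u t u s * C u m n); first by apply: eq_bigr => u _; rewrite CE.
  by rewrite h; apply: eq_bigr => u _; rewrite CE.
have SE i m n : skl_relations a b c i (mxtens_index (m, n)) = C i m n.
  by rewrite skl_relationsE CE.
have [G [X [X' [bigon sq sq']]]] := hecke_web_data hR SE RS C_cyc C_inj C_koszul.
have W : web q (nu q X) (nuV q X') C G.
  split=> //.
  - exact: (rot_nu q0 C_cyc C_inj bigon sq sq').
  - exact: (nu_invC q0 C_cyc C_inj bigon sq sq').
  - exact: (nuVK q0 C_cyc C_inj bigon sq sq').
  - exact: (square_nu q0 C_cyc C_inj bigon sq sq').
  - exact: (trace_nu q0 C_cyc bigon sq).
  - exact: (trace_nuV q0 C_cyc bigon sq').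
  move=> x h; apply: (skl_smooth abc0 skl_gen) => j; rewrite -[RHS](h j).
  by do 2!(apply: eq_bigr => ? _); rewrite CE.
have [q1 nu1] := web_rigid W q0 two0 three0.
(* As nu = 1 the standard basis is an eigenbasis, and c keeps its Sklyanin form in it. *)
have Pnu : 1%:M *m nu q X = diag_mx (const_mx 1) *m 1%:M.
  by rewrite nu1 diag_const_mx.
have := eigen_tensors W (unitmx1 _ _) Pnu; rewrite q1.
apply: (no_cyclic_dual abc0 skl_gen two0) => [x|i m n]; first by rewrite mxE.
by rewrite eigen_c1 CE.
Qed.

End NoSklyanin.

Theorem theorem5p1 (k : fieldType) (q : k) (R : 'M[k]_(3*3)) :
  2%N \notin [pchar k] -> 3%N \notin [pchar k] ->
  q != 0 -> hecke_symmetry q R ->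
  ~ AS_regular_typeA (sym_relations q R).
Proof.
move=> k2 k3 q0 hR [L [f [_ [a [b [c [abc0 [skl_gen [g [gU gS]]]]]]]]]].
have two0 : (2%:R : L) != 0 by rewrite -(rmorph_nat f) fmorph_eq0; move: k2; rewrite inE.
have three0 : (3%:R : L) != 0 by rewrite -(rmorph_nat f) fmorph_eq0; move: k3; rewrite inE.
have fq0 : f q != 0 by rewrite fmorph_eq0.
have hR' := hecke_symmetry_conj gU (hecke_symmetry_map f hR).
apply: (hecke_not_sklyanin two0 three0 fq0 abc0 skl_gen hR').
have TU : g *t g \in unitmx by apply: tensmx_unit.
have -> : invmx (g *t g) *m map_mx f R *m (g *t g) - (f q)%:M
    = invmx (g *t g) *m (map_mx f (sym_relations q R) *m (g *t g)).
  rewrite /sym_relations map_mxB map_scalar_mx mulmxA mulmxBr mulmxBl mul_mx_scalar.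
  by rewrite -scalemxAl mulVmx // scalemx1.
(* An invertible left factor does not change the row space, so the conjugated symmetry has the
   transported relations. *)
apply/eqmxP; apply: eqmx_trans (eqmxMfull _ _) (eqmxP gS).
by rewrite row_full_unit unitmx_inv.
Qed.
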